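(* Let $F$ be a perfect field of characteristic $p>0$ and $f\in P_{p^2}(F)$. Then $f$ has a $2$-collision $\{(g,h),(g^*,h^* )\}$ if and only if exactly one of the following holds (that is: for every $2$-collision $\{(g,h),(g^*,h^* )\}$ of $f$ exactly one of (F), (S), (M) holds, and conversely $f$ has a $2$-collision whenever one of them holds). (F) The polynomial $f$ is a Frobenius collision, i.e. $f = x^p\circ h_0 = \varphi_p(h_0)\circ x^p$ for some $h_0\in P_p(F)$ with $h_0\ne x^p$. (S) The polynomial $f$ is simply original and there are $u,s\in F^\times$, $\varepsilon\in\{0,1\}$, a positive divisor $m$ of $p-1$, and $w\in F$ such that $f^{[w]} = S(u,s,\varepsilon,m)$, and the collision $\{(g,h)^{[w]},(g^*,h^* )^{[w]}\}$ is contained in the $\#T$-collision $\{(g_t,h_t): t\in T\}$ of $S(u,s,\varepsilon,m)$, with $\#T\ge 2$. (M) The polynomial $f$ is multiply original and there are $b\in F^\times$, $a\in F\setminus\{0,b^p\}$, an integer $m$ with $1<m<p-1$, and $w\in F$ such that $f^{[w]} = M(a,b,m)$, and the collision $\{(g,h)^{[w]},(g^*,h^* )^{[w]}\}$ equals the $2$-collision $\{(g_M,h_M),(g_M^*,h_M^* )\}$ of $M(a,b,m)$.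
   Context: $P_n(F)$ is the set of monic original polynomials (leading coefficient $1$, constant coefficient $0$) of degree $n$ in $F[x]$. A $k$-collision of $f\in P_n(F)$ is a set of $k$ distinct pairs $(g,h)$ of monic original polynomials in $F[x]$ of degree at least $2$, all with $g\circ h=f$ and all with the same $\deg g$. $\varphi_p$ is the Frobenius endomorphism $a\mapsto a^p$ of $F$, applied to the coefficients of polynomials. Original shift: for $w\in F$ and $f\in P_n(F)$, $f^{[w]} = (x-f(w))\circ f\circ (x+w)\in P_n(F)$. For a pair, $(g,h)^{[w]} = (g^{[h(w)]},h^{[w]})$; if $f=g\circ h$, this is a decomposition of $f^{[w]}$. Simple collisions (here $r=p$): for $u,s\in F^\times$, $\varepsilon\in\{0,1\}$, $m$ a positive divisor of $p-1$, $\ell=(p-1)/m$, put $S(u,s,\varepsilon,m) = x(x^{\ell(p+1)}-\varepsilon u s^p x^\ell+us^{p+1})^m$, $T=\{t\in F: t^{p+1}-\varepsilon ut+u=0\}$, and for $t\in T$, $g_t = x(x^\ell-us^pt^{-1})^m$, $h_t=x(x^\ell-st)^m$. Then $S(u,s,\varepsilon,m)=g_t\circ h_t$ for all $t\in T$. Multiple collisions (here $r=p$): for $b\in F^\times$, $a\in F\setminus\{0,b^p\}$, $a^*=b^p-a$, $1<m<p-1$, $m^*=p-m$, put $M(a,b,m) = x^{mm^*}(x-b)^{mm^*}\bigl(x^m+a^*b^{-p}((x-b)^m-x^m)\bigr)^m\bigl(x^{m^*}+ab^{-p}((x-b)^{m^*}-x^{m^*})\bigr)^{m^*}$, $g_M=x^m(x-a)^{m^*}$,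 $h_M=x^p+a^*b^{-p}(x^{m^*}(x-b)^m-x^p)$, $g_M^*=x^{m^*}(x-a^* )^m$, $h_M^*=x^p+ab^{-p}(x^m(x-b)^{m^*}-x^p)$. Then $M(a,b,m)=g_M\circ h_M=g_M^*\circ h_M^*$. Simply/multiply original: let $K$ be an algebraic closure of $F$, $r$ a power of $p$, and let $f\in P_{r^2}(F)$ have a $2$-collision $\{(g,h),(g^*,h^* )\}$ satisfying: (A1) $f'\neq0$; (A2) $\deg g=\deg g^*=\deg h=\deg h^*$; (A3) $h,h^*$ have no common right component over $K$, i.e. there is no nonlinear $v\in K[x]$ with $h=u_1\circ v$ and $h^*=u_2\circ v$ for some $u_1,u_2\in K[x]$; (A4) for all $c\in K$, neither $g-c$ nor $g^*-c$ has a root in $K$ of multiplicity divisible by $p$; (A5) $\deg g'=\deg (h^* )'$. Then $f$ is called multiply original if there is some $c\in K$ such that $f-c$ has no simple roots in $K$, and simply original otherwise. (These terms are used only for $f$ having such a $2$-collision.) *)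

(* Defs.v *)
From HB Require Import structures.
From mathcomp Require Import all_boot all_order all_algebra all_field.
From mathcomp Require Import boolp classical_sets functions cardinality.
Set Implicit Arguments.
Unset Strict Implicit.
Unset Printing Implicit Defensive.
Import GRing.Theory.
Local Open Scope classical_set_scope.
Local Open Scope card_scope.
Local Open Scope ring_scope.

Definition exactly_one3 (A B C : Prop) : Prop :=
  (A /\ ~ B /\ ~ C) \/ (~ A /\ B /\ ~ C) \/ (~ A /\ ~ B /\ C).

Definition perfect_field (F : fieldType) : Prop :=
  forall q : {poly F}, irreducible_poly q -> separable_poly q.

Definition algebraic_closure_of (F : fieldType) (K : closedFieldType)
    (iota : {rmorphism F -> K}) : Prop :=
  forall z : K, algebraicOver iota z.

Section Collisions.
Variable F : fieldType.
Implicit Types (f g h : {poly F}) (gh : {poly F} * {poly F}) (w : F).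

(* The set P_n(F); recall that [size f] is the degree plus one. *)
Definition monic_original (n : nat) f : Prop :=
  [/\ f \is monic, f`_0 = 0 & size f = n.+1].

Definition decomposition f gh : Prop :=
  [/\ exists2 d : nat, (1 < d)%N & monic_original d gh.1,
      exists2 e : nat, (1 < e)%N & monic_original e gh.2
    & gh.1 \Po gh.2 = f].

Definition collision (k : nat) f (C : set ({poly F} * {poly F})) : Prop :=
  [/\ C #= `I_k,
      forall gh, C gh -> decomposition f gh
    & forall gh gh', C gh -> C gh' -> size gh.1 = size gh'.1].

Definition original_shift w f : {poly F} :=
  ('X - f.[w]%:P) \Po (f \Po ('X + w%:P)).

Definition pair_shift w gh : {poly F} * {poly F} :=
  (original_shift gh.2.[w] gh.1, original_shift w gh.2).

End Collisions.

Section SimpleCollisions.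
Variables (F : fieldType) (p : nat).

Definition simple_poly (u s eps : F) (m : nat) : {poly F} :=
  let l := (p.-1 %/ m)%N in
  'X * ('X^(l * p.+1) - (eps * u * s ^+ p) *: 'X^l + (u * s ^+ p.+1)%:P) ^+ m.

Definition simple_params (u eps : F) : set F :=
  [set t | t ^+ p.+1 - eps * u * t + u = 0].

Definition simple_left (u s : F) (m : nat) (t : F) : {poly F} :=
  'X * ('X^(p.-1 %/ m) - (u * s ^+ p * t^-1)%:P) ^+ m.

Definition simple_right (s : F) (m : nat) (t : F) : {poly F} :=
  'X * ('X^(p.-1 %/ m) - (s * t)%:P) ^+ m.

End SimpleCollisions.

Section MultipleCollisions.
Variables (F : fieldType) (p : nat).

Definition multiple_poly (a b : F) (m : nat) : {poly F} :=
  let astar := b ^+ p - a in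
  let mstar := (p - m)%N in
  'X^(m * mstar) * ('X - b%:P) ^+ (m * mstar)
  * ('X^m + (astar * b ^- p) *: (('X - b%:P) ^+ m - 'X^m)) ^+ m
  * ('X^mstar + (a * b ^- p) *: (('X - b%:P) ^+ mstar - 'X^mstar)) ^+ mstar.

Definition multiple_left (a : F) (m : nat) : {poly F} :=
  let mstar := (p - m)%N in
  'X^m * ('X - a%:P) ^+ mstar.

Definition multiple_right (a b : F) (m : nat) : {poly F} :=
  let astar := b ^+ p - a in
  let mstar := (p - m)%N in
  'X^p + (astar * b ^- p) *: ('X^mstar * ('X - b%:P) ^+ m - 'X^p).

Definition multiple_left_star (a b : F) (m : nat) : {poly F} :=
  let astar := b ^+ p - a in
  let mstar := (p - m)%N in
  'X^mstar * ('X - astar%:P) ^+ m.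

Definition multiple_right_star (a b : F) (m : nat) : {poly F} :=
  let mstar := (p - m)%N in
  'X^p + (a * b ^- p) *: ('X^m * ('X - b%:P) ^+ mstar - 'X^p).

End MultipleCollisions.

Section Original.
Variables (F : fieldType) (K : closedFieldType) (iota : {rmorphism F -> K}).
Variable p : nat.
Implicit Types (f g h gstar hstar : {poly F}).

Definition common_right_component h hstar : Prop :=
  exists v u1 u2 : {poly K},
    [/\ (2 < size v)%N, map_poly iota h = u1 \Po v
      & map_poly iota hstar = u2 \Po v].

Definition has_root_mult_dvd (q : {poly K}) : Prop :=
  exists2 z : K, root q z & (p %| mup z q)%N.

(* Comparing [size]s also compares degrees when a polynomial is zero. *)
Definition original_conditions f g h gstar hstar : Prop :=
  [/\ f^`() != 0,
      [/\ size g = size gstar, size gstar = size h & size h = size hstar],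
      ~ common_right_component h hstar,
      forall c : K, ~ has_root_mult_dvd (map_poly iota g - c%:P) /\
                    ~ has_root_mult_dvd (map_poly iota gstar - c%:P)
    & size g^`() = size hstar^`()].

Definition has_original_collision f : Prop :=
  exists e : nat, monic_original ((p ^ e) ^ 2) f /\
  exists g h gstar hstar : {poly F},
    collision 2 f [set (g, h); (gstar, hstar)] /\
    original_conditions f g h gstar hstar.

Definition no_simple_root (q : {poly K}) : Prop :=
  forall z : K, mup z q <> 1%N.

Definition multiply_original f : Prop :=
  has_original_collision f /\
  exists c : K, no_simple_root (map_poly iota f - c%:P).

Definition simply_original f : Prop :=
  has_original_collision f /\
  ~ exists c : K, no_simple_root (map_poly iota f - c%:P).

End Original.

Section Cases.
Variables (F : fieldType) (K : closedFieldType) (iota : {rmorphism F -> K}).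
Variables (p : nat) (charFp : p \in [pchar F]).
Implicit Types (f : {poly F}) (C : set ({poly F} * {poly F})).

Definition frobenius_collision f : Prop :=
  exists h0 : {poly F},
    [/\ monic_original p h0, h0 <> 'X^p, f = 'X^p \Po h0
      & f = map_poly (pFrobenius_aut charFp) h0 \Po 'X^p].

Definition simple_case f C : Prop :=
  simply_original iota p f /\
  exists (u s eps : F) (m : nat) (w : F),
    [/\ [/\ u != 0, s != 0, eps = 0 \/ eps = 1, (0 < m)%N & (m %| p.-1)%N],
        original_shift w f = simple_poly p u s eps m,
        pair_shift w @` C `<=`
          [set (simple_left p u s m t, simple_right p s m t)
             | t in simple_params p u eps]
      & `I_2 #<= simple_params p u eps].

Definition multiple_case f C : Prop :=
  multiply_original iota p f /\
  exists (a b : F) (m : nat) (w : F),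
    [/\ [/\ b != 0, a != 0, a != b ^+ p & (1 < m < p.-1)%N],
        original_shift w f = multiple_poly p a b m
      & pair_shift w @` C =
          [set (multiple_left p a m, multiple_right p a b m);
               (multiple_left_star p a b m, multiple_right_star p a b m)]].

End Cases.

(* Main.v *)
(* If [f' = 0], comparing derivatives forces one of the two decompositions to
   be [x^p o h0], and [f] is a Frobenius collision.

   Otherwise let [f = g o h = gs o hs] and work over the closure [K]. Since
   [0 < deg (hs - h) < p], the norm of [Y - hs] from [K(x)] to [K(h)] is
   [gs(Y) - g(h)], so for every [a] the values of [hs] on the fibre of [h]
   over [a] are the zeros of [gs - g(a)], with multiplicities. All four
   derivatives have the same degree, so the total ramification of [h]
   equals that of [gs]; since the former dominates the latter fibre by fibre,
   equality holds everywhere: a multiplicity [e > 1] of [gs - c] divides all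
   multiplicities of [g - c] but one, and symmetrically. Hence the
   multiplicities over a critical value are either [1, M, ..., M] on both
   sides, or [m, p - m] on both sides with [1 < m < p - 1]; moreover there is
   at most one critical value. The first pattern makes the four polynomials,
   after a shift, of the form [x (x^l - A)^M]; the second one yields a linear
   system for the factors of [h] and [hs]. The parameters are rational over [F]
   because they can be read off the two leading coefficients of derivatives. *)
Require Import Defs.
From mathcomp Require Import all_boot all_order all_algebra all_field.
From mathcomp Require Import zify ring.
From mathcomp Require Import boolp classical_sets functions cardinality.
Set Implicit Arguments.
Unset Strict Implicit.
Unset Printing Implicit Defensive.
Import GRing.Theory.
Local Open Scope classical_set_scope.
Local Open Scope ring_scope.

(** * Fibres of a collision *)

(** Primality of [p] makes the counts close up. A degree strictly between [0] and [p] is prime to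
    [p], so [hs - h] generates [K(x)] over [K(h)]. A polynomial of degree [p] with nonzero
    derivative has all multiplicities below [p], so its derivative vanishes to order exactly [e - 1]
    at a point of multiplicity [e], and total ramification is the degree of the derivative. Finally,
    the multiplicities in a fibre add up to [p], so no [e] with [1 < e < p] divides all of them:
    this is the origin of the exceptional point in each pattern. Equality of the degrees of the
    derivatives, condition (A5), has to be proved for an arbitrary collision with [f' != 0]; it
    comes from comparing degrees mod [p]. The local analysis at the points with [h(z) = a] and
    [hs(z) = b] rests on two relations: the chain rule for multiplicities, and the fact that the
    multiplicities of [h] at these points add up to that of [gs] at [b]. *)

Section Norm.
Variable K : fieldType.
Implicit Types (d g h H : {poly K}) (r : seq K).

(** Newton interpolation, with repeated nodes allowed. The value [a 0] is recorded because it
    becomes a diagonal entry of the matrix in [mul_char_poly]. *)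
Lemma newton_expansion d (zs : nat -> K) n : (size d <= n)%N ->
  exists a : nat -> K, a 0%N = d.[zs 0%N] /\
    d = \sum_(j < n) a j *: \prod_(i < j) ('X - (zs i)%:P).
Proof.
elim: n d zs => [|n IHn] d zs sz_d.
  have -> : d = 0 by apply/eqP; rewrite -size_poly_leq0.
  by exists (fun=> 0); rewrite horner0 big_ord0.
have /factor_theorem [d1 d1E] : root (d - d.[zs 0%N]%:P) (zs 0%N).
  by rewrite rootE !hornerE subrr.
have dE : d = d.[zs 0%N]%:P + d1 * ('X - (zs 0%N)%:P) by rewrite -d1E addrC subrK.
have [|a [_ d1_sum]] := IHn d1 (fun i => zs i.+1).
  have [->|d1_neq0] := eqVneq d1 0; first by rewrite size_poly0.
  have := size_Mmonic d1_neq0 (monicXsubC (zs 0%N)).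
  rewrite size_XsubC addn2 /= => sz_d1; rewrite -ltnS -sz_d1 -d1E.
  by rewrite (leq_trans (size_polyD _ _)) // geq_max sz_d size_polyN size_polyC; case: eqP.
exists (fun j => if j is k.+1 then a k else d.[zs 0%N]); split=> //.
rewrite {1}dE big_ord_recl big_ord0 alg_polyC; congr (_ + _).
rewrite {1}d1_sum mulr_suml; apply: eq_bigr => j _.
by rewrite big_ord_recl -scalerAl [in RHS]mulrC.
Qed.

(* The characteristic polynomial of multiplication by [d] on [K[x]], seen as a
   free module over [K[T]] with [T] acting as [H]. In the Newton basis attached
   to the roots of [H] the matrix is triangular at [T = 0]. *)
Lemma mul_char_poly r d (H := \prod_(z <- r) ('X - z%:P)) : (0 < size r)%N ->
  exists chi : {poly {poly K}},
    [/\ chi \is monic, size chi = (size r).+1,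
        (map_poly (comp_poly H) chi).[d] = 0
      & map_poly (horner_eval 0) chi = \prod_(z <- r) ('X - d.[z]%:P)].
Proof.
move=> r_gt0; set n := size r.
(* Continuing the roots of [H] periodically gives [N (q * n + k) = H ^+ q * N k], so
   [N 0, ..., N (n - 1)] is a basis of [K[x]] over [K[H]]. *)
pose zs i := nth 0 r (i %% n)%N.
pose N j := \prod_(i < j) ('X - (zs i)%:P).
have Hprod : H = N n.
  rewrite /H (big_nth 0) big_mkord; apply: eq_bigr => i _.
  by rewrite /zs modn_small.
have NnD k j : N (k + j)%N = N k * \prod_(i < j) ('X - (zs (k + i)%N)%:P).
  by rewrite /N big_split_ord.
have Nperiod q k : N (q * n + k)%N = H ^+ q * N k.
  elim: q => [|q IHq]; first by rewrite mul0n expr0 mul1r.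
  rewrite mulSn -addnA NnD -Hprod exprS -mulrA -IHq; congr (_ * _).
  by apply: eq_bigr => i _; rewrite /zs modnDl.
have expand (k : 'I_n) := @newton_expansion d (fun i => zs (k + i)%N) (size d) (leqnn _).
have [a aP] := fin_all_exists expand.
pose J := size d.
(* Column [k] expands [d * N k] by a Newton expansion started at node [k]; an index [k + j] that
   passes [n] wraps around at the cost of a power of [T]. *)
pose M : 'M[{poly K}]_n := \matrix_(i < n, k < n)
  \sum_(j < J | ((k + j) %% n)%N == i) a k j *: 'X^((k + j) %/ n).
exists (char_poly M); split.
- exact: char_poly_monic.
- exact: size_char_poly.
- rewrite map_char_poly /char_poly -horner_evalE -det_map_mx.
  set B := map_mx _ (char_poly_mx _).
  pose v : 'rV[{poly K}]_n := \row_i N i.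
  (* The row of basis elements is annihilated by the characteristic matrix at [Y = d], [T = H];
     multiplying by the adjugate leaves the determinant times [N 0 = 1]. *)
  have vB0 : v *m B = 0.
    apply/rowP=> k; rewrite !mxE.
    have -> : \sum_j v 0 j * B j k =
        v 0 k * d - \sum_j v 0 j * (map_mx (comp_poly H) M) j k.
      rewrite [v 0 k * d](_ : _ = \sum_j v 0 j * (d *+ (j == k))); last first.
        rewrite (bigD1 k) //= eqxx mulr1n big1 ?addr0 // => j /negPf ->.
        by rewrite mulr0n mulr0.
      rewrite -sumrB; apply: eq_bigr => j _.
      rewrite -mulrBr; congr (_ * _).
      by rewrite !mxE raddfB raddfMn /= /horner_eval hornerX hornerC.
    apply/eqP; rewrite subr_eq0; apply/eqP.
    have [_ dE] := aP k.
    rewrite mxE {1}dE mulr_sumr.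
    transitivity (\sum_(j < J) a k j *: N (k + j)%N).
      by apply: eq_bigr => j _; rewrite NnD -scalerAr.
    transitivity (\sum_(j < J) \sum_(i < n | ((k + j) %% n)%N == i)
        N i * (a k j *: H ^+ ((k + j) %/ n))).
      apply: eq_bigr => j _.
      have lt_n : ((k + j) %% n < n)%N by rewrite ltn_mod.
      rewrite (big_pred1 (Ordinal lt_n)) => [|i]; last by rewrite eq_sym.
      by rewrite /= {1}(divn_eq (k + j) n) Nperiod -scalerAr mulrC.
    rewrite (exchange_big_dep xpredT) //=; apply: eq_bigr => i _.
    rewrite !mxE linear_sum mulr_sumr; apply: eq_bigr => j _.
    by rewrite linearZ /= rmorphXn /= comp_polyX.
  have /matrixP/(_ 0 (Ordinal r_gt0)) := congr1 (mulmx^~ (\adj B)) vB0.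
  rewrite -mulmxA mul_mx_adj mul0mx mul_mx_scalar !mxE /N big_ord0 mulr1.
  by [].
(* At [T = 0] only the indices that do not wrap survive: [M] becomes lower triangular with diagonal
   entries [d.[zs k]]. *)
- have M0 (i k : 'I_n) : map_mx (horner_eval 0) M i k =
      \sum_(j < J | (k + j == i)%N) a k j.
    rewrite !mxE raddf_sum /= big_mkcond [RHS]big_mkcond; apply: eq_bigr => j _.
    rewrite /horner_eval hornerZ hornerXn expr0n.
    case: (ltnP (k + j) n) => [lt_n|ge_n].
      by rewrite modn_small ?divn_small // mulr1.
    have /negPf -> : (k + j != i)%N by rewrite gtn_eqF // (leq_trans (ltn_ord i)).
    by rewrite eqn0Ngt divn_gt0 // ge_n mulr0 if_same.
  rewrite map_char_poly char_poly_trig.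
    rewrite [RHS](big_nth 0) big_mkord; apply: eq_bigr => k _.
    rewrite M0; congr ('X - _%:P).
    have [a0 dE] := aP k.
    have [J0|J_gt0] := posnP J.
      have d0 : d = 0 by apply/eqP; rewrite -size_poly_eq0 -/J J0.
      rewrite big1 ?d0 ?horner0 // => -[j lt_jJ]; exfalso; move: lt_jJ.
      by rewrite J0.
    rewrite (big_pred1 (Ordinal J_gt0)) /= => [|j].
      by rewrite a0 addn0 /zs modn_small.
    by rewrite -[X in _ == X]addn0 eqn_add2l.
  apply/is_trig_mxP => i k lt_ik; rewrite M0 big_pred0 // => j.
  by rewrite gtn_eqF // (leq_trans lt_ik) // leq_addr.
Qed.

(** The nonzero terms [E_k(H) d^k] have degrees congruent to [k deg d] mod [n], pairwise distinct
    for [k < n], so the term of largest degree cannot cancel. *)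
Lemma eval_independent (n : nat) H d (E : {poly {poly K}}) :
  size H = n.+1 -> d != 0 -> coprime n (size d).-1 -> (size E <= n)%N ->
  (map_poly (comp_poly H) E).[d] = 0 -> E = 0.
Proof.
move=> szH d_neq0 cop szE E0; apply/eqP/negP => /negP E_neq0.
have szE_gt0 : (0 < size E)%N by rewrite lt0n size_poly_eq0.
have n_gt0 : (0 < n)%N by exact: leq_trans szE.
have H_gt1 : (1 < size H)%N by rewrite szH.
pose t (k : 'I_(size E)) := (E`_k \Po H) * d ^+ k.
have tsum : \sum_k t k = 0.
  rewrite -[RHS]E0 (horner_coef_wide _ (size_poly _ _)).
  by apply: eq_bigr => k _; rewrite coef_map.
have t_neq0 (k : 'I_(size E)) : E`_k != 0 -> t k != 0.
  move=> Ek; rewrite mulf_neq0 ?expf_neq0 //.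
  by rewrite -lead_coef_eq0 lead_coef_comp // mulf_neq0 ?expf_neq0 //
    lead_coef_eq0 // -size_poly_gt0 szH.
have szt (k : 'I_(size E)) : E`_k != 0 ->
    (size (t k)).-1 = ((size (E`_k)%R).-1 * n + (size d).-1 * k)%N.
  move=> Ek; have := t_neq0 _ Ek; rewrite mulf_eq0 negb_or => /andP[c0 e0].
  have := size_comp_poly E`_k H; rewrite szH /= => <-.
  rewrite size_mul // -size_exp.
  rewrite -!size_poly_gt0 in c0 e0.
  by case: (size _) c0 => // x _; case: (size _) e0 => // y _; rewrite addSn addnS.
have szt_inj (k k' : 'I_(size E)) : E`_k != 0 -> E`_k' != 0 ->
    size (t k) = size (t k') -> k = k'.
  move=> Ek Ek' /(congr1 predn); rewrite !szt // => /(congr1 (modn^~ n)).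
  wlog le_kk' : k k' {Ek Ek'} / (k <= k')%N => [IH|].
    by case: (leqP k k') => [/IH|/ltnW/IH/[swap] eqm /(_ (esym eqm))] // ->.
  rewrite !modnMDl => /esym/eqP; rewrite eqn_mod_dvd ?leq_mul2l ?le_kk' ?orbT //.
  rewrite -mulnBr Gauss_dvdr // => dvd_n; apply: val_inj => /=.
  apply/eqP; rewrite eqn_leq le_kk' /= leqNgt; apply/negP => lt_kk'.
  have /dvdn_leq/(_ dvd_n) : (0 < k' - k)%N by rewrite subn_gt0.
  rewrite leqNgt => /negP; apply.
  exact: leq_ltn_trans (leq_subr _ _) (leq_trans (ltn_ord k') szE).
have lt_last : ((size E).-1 < size E)%N by rewrite ltn_predL.
have [|k0 /= Pk0 max_k0] := @arg_maxnP _ (Ordinal lt_last)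
  (fun k : 'I_(size E) => E`_k != 0) (fun k => size (t k)).
  by rewrite /= -lead_coefE lead_coef_eq0.
have /(congr1 (fun q : {poly K} => q`_(size (t k0)).-1)) := tsum.
rewrite coef0 coef_sum (bigD1 k0) //= big1 ?addr0 => [/eqP|k k_neq].
  by rewrite -lead_coefE lead_coef_eq0 (negPf (t_neq0 _ Pk0)).
have [Ek0|Ek] := eqVneq E`_k 0; first by rewrite /t Ek0 comp_poly0 mul0r coef0.
rewrite nth_default // -ltnS prednK ?size_poly_gt0 ?t_neq0 // ltn_neqAle.
rewrite (max_k0 k Ek) andbT; apply/eqP => /(szt_inj _ _ Ek Pk0) /eqP.
by rewrite (negPf k_neq).
Qed.

Lemma size_monicB (R : nzRingType) n (P Q : {poly R}) :
  P \is monic -> Q \is monic -> size P = n.+1 -> size Q = n.+1 ->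
  (size (P - Q)%R <= n)%N.
Proof.
move=> /monicP P1 /monicP Q1 szP szQ; apply/leq_sizeP => j.
rewrite leq_eqVlt coefB => /predU1P[<-|lt_nj].
  by move: P1 Q1; rewrite !lead_coefE szP szQ /= => -> ->; rewrite subrr.
by rewrite !nth_default ?szP ?szQ ?subrr.
Qed.

(* [1, d, ..., d^(p-1)] are independent over [K[H]] because their degrees are
   distinct mod [p]; hence the characteristic polynomial of [d] over [K[T]] is
   [gs(Y + T + a) - g(T + a)], and it remains to set [T = 0]. *)
Lemma fiber_poly (p : nat) (g h gs hs : {poly K}) (a : K) (r : seq K) :
  prime p -> g \is monic -> size g = p.+1 -> gs \is monic -> size gs = p.+1 ->
  size h = p.+1 -> (1 < size (hs - h)%R <= p)%N -> g \Po h = gs \Po hs ->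
  h - a%:P = \prod_(z <- r) ('X - z%:P) ->
  gs - g.[a]%:P = \prod_(z <- r) ('X - hs.[z]%:P).
Proof.
move=> p_pr g_monic szg gs_monic szgs szh szd gh rE.
set d := hs - h in szd *.
have szr : size r = p.
  apply: succn_inj; rewrite -(size_prod_XsubC r id) -rE -szh.
  by rewrite size_polyDl // size_polyN size_polyC szh ltnS (leq_trans (leq_b1 _)) ?prime_gt0.
have r_gt0 : (0 < size r)%N by rewrite szr prime_gt0.
have [chi [chi_monic szchi chi0 chi_spec]] := mul_char_poly d r_gt0.
rewrite -rE in chi0.
set H := h - a%:P in chi0 rE.
pose Ta : {poly K} := 'X + a%:P.
(* At [T = H] and [Y = d] one has [Ta = h] and [Y + Ta = hs], so [E] vanishes there because
   [g(h) = gs(hs)]. *)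
pose E : {poly {poly K}} := map_poly polyC gs \Po ('X + Ta%:P) - (g \Po Ta)%:P.
have X_alpha : 'X + Ta%:P = 'X - (- Ta)%:P by rewrite polyCN opprK.
have P_monic : map_poly polyC gs \Po ('X + Ta%:P) \is monic.
  rewrite monicE lead_coef_comp X_alpha ?size_XsubC // lead_coefXsubC expr1n mulr1.
  by rewrite lead_coef_map_id0 ?(monicP gs_monic) //= polyC_eq0 oner_neq0.
have szP : size (map_poly polyC gs \Po ('X + Ta%:P)) = p.+1.
  by rewrite size_comp_poly2 ?X_alpha ?size_XsubC // size_map_polyC.
have ltC : (size (- (g \Po Ta)%:P) <= 1)%N.
  by rewrite size_polyN size_polyC leq_b1.
have p_gt0 := prime_gt0 p_pr.
have chiE : chi = E.
  apply/eqP; rewrite -subr_eq0; apply/eqP.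
  apply: (@eval_independent p H d).
  - by rewrite rE size_prod_XsubC szr.
  - by rewrite -size_poly_gt0; case: (size d) szd.
  - rewrite prime_coprime // gtnNdvd //; case: (size d) szd => [|[|k]] //=.
  - apply: size_monicB => //; rewrite ?szchi ?szr //.
      by rewrite monicE lead_coefDl ?szP // -?monicE // (leq_ltn_trans ltC).
    by rewrite size_polyDl ?szP // (leq_ltn_trans ltC).
  rewrite rmorphB hornerD hornerN chi0 sub0r; apply/eqP; rewrite oppr_eq0.
  rewrite /E rmorphB /= hornerD hornerN subr_eq0 map_comp_poly /= horner_comp.
  rewrite rmorphD /= map_polyX !map_polyC /= !hornerE.
  have TaH : Ta \Po H = h by rewrite comp_polyD comp_polyX comp_polyC subrK.
  rewrite -comp_polyA TaH gh addrC subrKC -map_poly_comp.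
  by apply/eqP; congr _.[hs]; apply: eq_map_poly => x /=; rewrite comp_polyC.
have : map_poly (horner_eval 0) chi = (gs - g.[a]%:P) \Po ('X + a%:P).
  rewrite chiE /E rmorphB /= map_comp_poly rmorphD /= map_polyX !map_polyC /=.
  rewrite comp_polyB comp_polyC -map_poly_comp map_poly_id /= => [|x _].
    by rewrite /horner_eval !hornerE horner_comp !hornerE.
  by rewrite /= /horner_eval hornerC.
rewrite chi_spec => /(congr1 (comp_poly ('X - a%:P))).
rewrite comp_polyXaddC_K => <-; rewrite rmorph_prod; apply: eq_big_seq => z z_r.
rewrite /= comp_polyB comp_polyX comp_polyC.
have : root H z by rewrite rE root_prod_XsubC.
rewrite rootE /H /d !hornerE subr_eq0 => /eqP ->.
by rewrite polyCB opprB addrA subrK.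
Qed.
End Norm.

(** * Degrees of the derivatives *)
Section DerivativeDegrees.
Variable F : fieldType.
Implicit Types (G P Q g h gs hs : {poly F}).

Lemma size_deriv_neq0 P : (size P).-1%:R != 0 :> F ->
  (size P^`()).+1 = size P /\ lead_coef P^`() = lead_coef P *+ (size P).-1.
Proof.
have [->|P_neq0] := eqVneq P 0; first by rewrite size_poly0 eqxx.
move=> n_neq0; have szP := lt_size_deriv P_neq0.
case: (size P) (lead_coefE P) n_neq0 szP => [|[|n]] //= PE; first by rewrite eqxx.
move=> n_neq0; rewrite ltnS => szP.
have top : P^`()`_n != 0.
  rewrite coef_deriv -mulr_natr mulf_neq0 // -[n.+1]/n.+2.-1.
  by rewrite -PE lead_coef_eq0.
have szE : size P^`() = n.+1.
  apply/eqP; rewrite eqn_leq szP ltnNge; apply/negP => /leq_sizeP/(_ n (leqnn n)).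
  by move/eqP; rewrite (negPf top).
by rewrite lead_coefE szE coef_deriv PE.
Qed.

Lemma size_sum_monic n k (Q : 'I_k -> {poly F}) :
  (forall i, Q i \is monic) -> (forall i, size (Q i) = n.+1) -> k%:R != 0 :> F ->
  size (\sum_i Q i) = n.+1.
Proof.
move=> Q_monic szQ k_neq0; apply/eqP; rewrite eqn_leq.
rewrite (leq_trans (size_sum _ _ _)) /=; last first.
  by apply/bigmax_leqP => i _; rewrite szQ.
rewrite ltnNge; apply/negP => /leq_sizeP/(_ n (leqnn n)).
rewrite coef_sum (eq_bigr (fun=> 1)) => [|i _]; last first.
  by have /monicP := Q_monic i; rewrite lead_coefE szQ.
by rewrite sumr_const card_ord => /eqP; rewrite (negPf k_neq0).
Qed.

(** [P - Q] divides the difference, and the leading coefficient of the cofactor is [deg G] times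
    that of [G], nonzero by the hypothesis on [(size G).-1]. *)
Lemma size_compB n G P Q : (0 < n)%N -> P \is monic -> Q \is monic ->
  size P = n.+1 -> size Q = n.+1 -> (1 < size G)%N -> (size G).-1%:R != 0 :> F ->
  P != Q -> size ((G \Po P) - (G \Po Q)) = (size (P - Q)%R + n * (size G).-2)%N.
Proof.
move=> n_gt0 P_monic Q_monic szP szQ szG G_neq0 PQ.
case szGE: (size G) szG G_neq0 => [|[|m]] //= _ m_neq0.
pose V k : {poly F} := \sum_(a < k) P ^+ (k.-1 - a) * Q ^+ a.
have szV k a : (a < k)%N -> size (P ^+ (k.-1 - a) * Q ^+ a) = (n * k.-1).+1.
  move=> lt_ak; have k_gt0 : (0 < k)%N by exact: leq_trans lt_ak.
  have : P ^+ (k.-1 - a) * Q ^+ a \is monic by rewrite rpredM ?rpredX.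
  move=> /monic_neq0; rewrite mulf_eq0 negb_or => /andP[c0 e0].
  rewrite size_mul // -(prednK (_ : 0 < size (P ^+ _))%N) ?size_poly_gt0 //.
  rewrite -(prednK (_ : 0 < size (Q ^+ _))%N) ?size_poly_gt0 // !size_exp szP szQ /=.
  by rewrite addnS -mulnDr subnK // -ltnS (prednK k_gt0).
have szVle k : (size (V k) <= (n * k.-1).+1)%N.
  by rewrite (leq_trans (size_sum _ _ _)) //; apply/bigmax_leqP => a _; rewrite szV.
pose W := \sum_(k < m.+2) G`_k *: V k.
have WE : (G \Po P) - (G \Po Q) = (P - Q) * W.
  rewrite !comp_polyE -sumrB szGE mulr_sumr; apply: eq_bigr => k _.
  by rewrite -scalerBr subrXX -scalerAr.
have szW : size W = (n * m).+1.
  have G_top : G`_m.+1 != 0.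
    by have := lead_coef_eq0 G; rewrite lead_coefE szGE /= -size_poly_eq0 szGE => ->.
  have szVm : size (V m.+1) = (n * m).+1.
    apply: size_sum_monic => // a; last by rewrite szV.
    by rewrite rpredM ?rpredX.
  rewrite /W big_ord_recr /= addrC size_polyDl size_scale // szVm //.
  rewrite ltnS (leq_trans (size_sum _ _ _)) //; apply/bigmax_leqP => k _.
  case: k => [[|k] ltk] /=; first by rewrite /V big_ord0 scaler0 size_poly0.
  rewrite (leq_trans (size_scale_leq _ _)) // (leq_trans (szVle k.+1)) //=.
  have lt_km : (k < m)%N := ltk.
  by rewrite -(ltn_pmul2l n_gt0) in lt_km.
have W_neq0 : W != 0 by rewrite -size_poly_gt0 szW.
by rewrite WE size_mul ?subr_eq0 // szW addnS.
Qed.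

Lemma natf_neq0_lt p n : p \in [pchar F] -> (0 < n < p)%N -> n%:R != 0 :> F.
Proof.
by move=> charFp /andP[n_gt0 lt_np]; rewrite -(dvdn_pcharf charFp) gtnNdvd.
Qed.

Lemma deriv_Xp p : p \in [pchar F] -> ('X^p : {poly F})^`() = 0.
Proof. by move=> charFp; rewrite derivXn -mulr_natr -polyC_natr (pcharf0 charFp) mulr0. Qed.

Lemma size_subXn n P : P \is monic -> size P = n.+1 -> (size (P - 'X^n)%R <= n)%N.
Proof. by move=> Pm szP; apply: size_monicB; rewrite ?monicXn ?size_polyXn. Qed.

Lemma size_deriv_subXp p P : p \in [pchar F] -> P \is monic -> size P = p.+1 ->
  P^`() != 0 ->
  [/\ (1 < size (P - 'X^p)%R <= p)%N, (size P^`()).+1 = size (P - 'X^p)%R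
    & lead_coef P^`() = lead_coef (P - 'X^p) *+ (size (P - 'X^p)%R).-1].
Proof.
move=> charFp Pm szP; have := size_subXn Pm szP.
have -> : P^`() = (P - 'X^p)^`() by rewrite derivB deriv_Xp ?subr0.
set Q := P - 'X^p => szQ dQ.
have szQ1 : (1 < size Q)%N.
  rewrite ltnNge; apply: contraNN dQ => /size1_polyC ->; by rewrite derivC.
have Q_neq0 : (size Q).-1%:R != 0 :> F.
  by rewrite (natf_neq0_lt charFp) //; case: (size Q) szQ szQ1 => [|[|k]].
by have [] := size_deriv_neq0 Q_neq0; rewrite szQ1 szQ.
Qed.

(** Since [f' = g'(h) h'], the degree of [f'] is [p deg g' + deg h'] with [deg h' < p]; division by
    [p] yields the first two equalities. The third compares [g(h)] with [gs(hs)] once the additive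
    term [x^p] is split off from [g] and [gs]. *)
Lemma size_deriv_collision p g h gs hs : p \in [pchar F] ->
  g \is monic -> h \is monic -> gs \is monic -> hs \is monic ->
  size g = p.+1 -> size h = p.+1 -> size gs = p.+1 -> size hs = p.+1 ->
  h`_0 = 0 -> hs`_0 = 0 -> h != hs -> g \Po h = gs \Po hs -> (g \Po h)^`() != 0 ->
  [/\ size g^`() = size gs^`(), size h^`() = size hs^`() & size g^`() = size hs^`()].
Proof.
move=> charFp g_m h_m gs_m hs_m szg szh szgs szhs h0 hs0 hhs gh df_neq0.
have p_gt0 : (0 < p)%N := prime_gt0 (pcharf_prime charFp).
have df_h := deriv_comp g h; have df_hs := deriv_comp gs hs.
rewrite -gh in df_hs.
have [dgh_neq0 dh_neq0] : g^`() \Po h != 0 /\ h^`() != 0.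
  by apply/andP; rewrite -negb_or -mulf_eq0 -df_h.
have [dgs_neq0 dhs_neq0] : gs^`() \Po hs != 0 /\ hs^`() != 0.
  by apply/andP; rewrite -negb_or -mulf_eq0 -df_hs.
have dg_neq0 : g^`() != 0 by apply: contraNneq dgh_neq0 => ->; rewrite comp_poly0.
have dgs0 : gs^`() != 0 by apply: contraNneq dgs_neq0 => ->; rewrite comp_poly0.
have [szG szdg leadg] := size_deriv_subXp charFp g_m szg dg_neq0.
have [szGs szdgs leadgs] := size_deriv_subXp charFp gs_m szgs dgs0.
have [szH szdh leadh] := size_deriv_subXp charFp h_m szh dh_neq0.
have [szHs szdhs leadhs] := size_deriv_subXp charFp hs_m szhs dhs_neq0.
set G := g - 'X^p in szG szdg leadg; set Gs := gs - 'X^p in szGs szdgs leadgs.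
set H := h - 'X^p in szH szdh leadh; set Hs := hs - 'X^p in szHs szdhs leadhs.
have szc : (size (g^`() \Po h)).-1 = ((size g^`()).-1 * p)%N.
  by rewrite size_comp_poly szh.
have szcs : (size (gs^`() \Po hs)).-1 = ((size gs^`()).-1 * p)%N.
  by rewrite size_comp_poly szhs.
have [szGG szHH] : size G = size Gs /\ size H = size Hs.
  have := congr1 (fun q : {poly F} => size q) df_hs; rewrite {1}df_h !size_mul //.
  rewrite -!size_poly_gt0 in dgh_neq0 dh_neq0 dgs_neq0 dhs_neq0.
  move: szc szcs szdg szdgs szdh szdhs szG szGs szH szHs dgh_neq0 dh_neq0 dgs_neq0 dhs_neq0.
  move: (size G) (size Gs) (size H) (size Hs) => G1 Gs1 H1 Hs1.
  move: (size (g^`() \Po h)) (size (gs^`() \Po hs)) => [|c1] [|c2] //= -> ->.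
  move: (size g^`()) (size gs^`()) => dg dgs <- <-.
  move: (size h^`()) (size hs^`()) => [|dh] [|dhs] // <- <-; rewrite !ltnS.
  move=> /andP[dg_gt0 _] /andP[dgs_gt0 _] /andP[_ lt_dh] /andP[_ lt_dhs] _ _ _ _.
  rewrite !addnS => /succn_inj eq_sz.
  have eq_dh : dh = dhs.
    by have := congr1 (modn^~ p) eq_sz; rewrite !modnMDl !modn_small // ltnW.
  move: eq_sz; rewrite eq_dh => /addIn/eqP; rewrite eqn_pmul2r // => /eqP eq_dg.
  by rewrite -(prednK dg_gt0) eq_dg (prednK dgs_gt0).
have [eqg eqh] : size g^`() = size gs^`() /\ size h^`() = size hs^`().
  by split; apply: succn_inj; rewrite ?szdg ?szdgs ?szdh ?szdhs.
split=> //; rewrite -eqh; apply: succn_inj; rewrite szdg szdh.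
pose d := hs - h; pose E := Gs - G.
have d_neq0 : d != 0 by rewrite subr_eq0 eq_sym.
have dE : d = Hs - H by rewrite /Hs /H opprB addrA subrK.
have szd1 : (1 < size d)%N.
  rewrite ltnNge; apply: contraNN d_neq0 => /size1_polyC ->.
  by rewrite coefB h0 hs0 subrr.
have szd2 : (size d <= size Hs)%N.
  by rewrite dE (leq_trans (size_polyD _ _)) // size_polyN szHH maxnn.
have szE2 : (size E <= size Gs)%N.
  by rewrite (leq_trans (size_polyD _ _)) // size_polyN szGG maxnn.
have charP : p \in [pchar {poly F}] by rewrite pchar_poly.
have p_nat : [pchar {poly F}].-nat p by rewrite pnatE // (pcharf_prime charFp).
(* The left-hand side has degree prime to [p] and the two terms on the right
   have degrees divisible by [p], so the latter cancel at the top. *)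
have eqE : (Gs \Po hs) - (Gs \Po h) = - (d ^+ p + (E \Po h)).
  rewrite /d (exprDn_pchar _ _ p_nat) (exprNn_pchar _ p_nat).
  have -> : Gs \Po hs = (G \Po h) + h ^+ p - hs ^+ p.
    rewrite /Gs /G !comp_polyB -gh !rmorphXn /= !comp_polyX; by ring.
  by rewrite (comp_polyB Gs G h : E \Po h = _); ring.
have Gs_neq0 : (size Gs).-1%:R != 0 :> F.
  by rewrite (natf_neq0_lt charFp) //; case: (size Gs) szGs => [|[|k]].
have /andP[Gs_gt1 Gs_lep] := szGs.
rewrite eq_sym in hhs.
have := size_compB p_gt0 hs_m h_m szhs szh Gs_gt1 Gs_neq0 hhs.
rewrite -/d eqE size_polyN => szL.
have d_small : ((size d).-1 %% p)%N = (size d).-1.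
  by rewrite modn_small //; move: szHs szd1 szd2; clear; move: (size Hs) (size d); lia.
have not_mult (Q : {poly F}) k : (size Q).-1 = (k * p)%N ->
    size Q <> (size d + p * (size Gs).-2)%N.
  move=> szQ szQ'; move: szQ; rewrite szQ' -(prednK (ltnW szd1)) addSn /=.
  move=> /(congr1 (modn^~ p)); rewrite modnMl mulnC addnC modnMDl d_small.
  by move: szd1; clear; move: (size d); lia.
have szEd_pow : size (E \Po h) = size (d ^+ p).
  case: (ltngtP (size (E \Po h)) (size (d ^+ p))) => // lt_sz; exfalso.
    rewrite size_polyDl // in szL; apply: not_mult szL.
    by rewrite size_exp.
  rewrite addrC size_polyDl // in szL; apply: not_mult szL.
  by rewrite size_comp_poly szh.
have := size_comp_poly E h; rewrite szEd_pow size_exp szh /= => /eqP.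
rewrite eqn_pmul2r // => /eqP szEd.
have le_Gs_d : (size Gs <= size d)%N.
  have : (size (d ^+ p + (E \Po h))%R <= (p * (size d).-1).+1)%N.
    rewrite (leq_trans (size_polyD _ _)) // szEd_pow maxnn mulnC -size_exp.
    exact: leqSpred.
  rewrite szL -(prednK (ltnW szd1)) addSn ltnS => le1.
  rewrite leqNgt; apply/negP => lt_d.
  have : (p * (size d).-1 <= p * (size Gs).-2)%N.
    by rewrite leq_pmul2l //; move: lt_d; clear; move: (size Gs) (size d); lia.
  move: le1 szd1 p_gt0; clear; move: (size d) (p * _)%N (p * _)%N; lia.
have {szEd} szEd : size E = size d by move: szEd szd1; clear; move: (size E) (size d); lia.
(* At this point [Gs], [E] and [d] have the same degree. If it were below [deg Hs], then [H] and
   [Hs = H + d] would share their leading coefficient; through [f'] so would [G] and [Gs], and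
   [E = Gs - G] would have degree below that of [Gs]. *)
have [lt_GH|] := ltnP (size Gs) (size Hs); last first.
  rewrite szGG szHH; move: szEd le_Gs_d szE2 szd2; clear.
  by move: (size Gs) (size Hs) (size E) (size d); lia.
exfalso; have leadHs : lead_coef Hs = lead_coef H.
  have -> : Hs = H + d by rewrite dE addrC subrK.
  by rewrite lead_coefDl // szHH -szEd (leq_ltn_trans szE2).
have leadG : lead_coef Gs = lead_coef G.
  move: df_hs; rewrite df_h => /(congr1 lead_coef).
  rewrite !lead_coefM !lead_coef_comp ?szh ?szhs ?ltnS //.
  rewrite (monicP h_m) (monicP hs_m) !expr1n !mulr1 leadg leadgs leadh leadhs.
  rewrite leadHs szHH szGG -(mulr_natr (lead_coef G)).
  rewrite -(mulr_natr (lead_coef Gs)) -(mulr_natr (lead_coef H)) => eq_lead.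
  have H_neq0 : lead_coef H * (size Hs).-1%:R != 0.
    rewrite mulf_neq0 //; first by rewrite lead_coef_eq0 -size_poly_gt0; case: (size H) szH.
    by rewrite (natf_neq0_lt charFp) //; case: (size Hs) szHs => [|[|k]].
  by move/(mulIf H_neq0)/(mulIf Gs_neq0): eq_lead.
have : (size E < size Gs)%N.
  case szGsE: (size Gs) Gs_gt1 => [|n] // _; rewrite ltnS.
  apply/leq_sizeP => j; rewrite leq_eqVlt coefB => /predU1P[<-|lt_nj].
    by move: leadG; rewrite !lead_coefE szGG szGsE /= => ->; rewrite subrr.
  by rewrite !nth_default ?szGG ?szGsE ?subrr.
by rewrite szEd ltnNge le_Gs_d.
Qed.
End DerivativeDegrees.

(** * Ramification of polynomial maps *)
Section Ramification.
Variable K : closedFieldType.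
Implicit Types (P Q g h q : {poly K}) (z c : K) (s : seq K).

Definition zeros q : seq K := sval (closed_field_poly_normal q).

Lemma zerosE q : q = lead_coef q *: \prod_(z <- zeros q) ('X - z%:P).
Proof. exact: (svalP (closed_field_poly_normal q)). Qed.

Lemma zeros_monic q : q \is monic -> q = \prod_(z <- zeros q) ('X - z%:P).
Proof. by move=> /monicP lq; rewrite {1}(zerosE q) lq scale1r. Qed.

Lemma size_zeros q : q != 0 -> size (zeros q) = (size q).-1.
Proof.
move=> q_neq0.
by rewrite {2}(zerosE q) size_scale ?lead_coef_eq0 // size_prod_XsubC.
Qed.

Lemma mup_zeros q z : q != 0 -> mup z q = count_mem z (zeros q).
Proof.
move=> q_neq0; rewrite {1}(zerosE q) -mul_polyC mupMr ?mu_prod_XsubC //.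
by rewrite rootC lead_coef_eq0.
Qed.

Lemma mem_zeros q z : q != 0 -> (z \in zeros q) = root q z.
Proof.
by move=> q_neq0; rewrite {2}(zerosE q) rootZ ?lead_coef_eq0 // root_prod_XsubC.
Qed.

Lemma mup_gt0 q z : q != 0 -> (0 < mup z q)%N = root q z.
Proof. by move=> q0; rewrite mup_zeros // -has_count has_pred1 mem_zeros. Qed.

Lemma sum_count_mem s r : uniq s ->
  (\sum_(z <- s) count_mem z r = count [in s] r)%N.
Proof.
move=> s_uniq; elim: r => [|x r IHr] /=; first by rewrite big1.
rewrite big_split /= IHr; congr (_ + _)%N.
under eq_bigr do rewrite eq_sym.
by rewrite -count_uniq_mem // -sum1_count [RHS]big_mkcond.
Qed.

Lemma sum_mup_le q s : q != 0 -> uniq s ->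
  (\sum_(z <- s) mup z q <= (size q).-1)%N.
Proof.
move=> q_neq0 s_uniq; under eq_bigr do rewrite mup_zeros //.
by rewrite sum_count_mem // -size_zeros // count_size.
Qed.

Lemma sum_mup q s : q != 0 -> uniq s -> (forall z, root q z -> z \in s) ->
  (\sum_(z <- s) mup z q = (size q).-1)%N.
Proof.
move=> q_neq0 s_uniq s_all; under eq_bigr do rewrite mup_zeros //.
rewrite sum_count_mem // -size_zeros //; apply/eqP; rewrite -all_count.
by apply/allP => z; rewrite mem_zeros //= => /s_all.
Qed.

Lemma eq_mup P Q : P \is monic -> Q \is monic ->
  (forall z, mup z P = mup z Q) -> P = Q.
Proof.
move=> P_monic Q_monic eqPQ.
rewrite (zeros_monic P_monic) (zeros_monic Q_monic); apply: perm_big.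
by apply/allP => z _ /=; rewrite -!mup_zeros ?monic_neq0 // eqPQ.
Qed.

Definition ram q z : nat := mup z (q - q.[z]%:P).

Lemma subC_neq0 q c : (1 < size q)%N -> q - c%:P != 0.
Proof.
move=> szq; rewrite subr_eq0; apply: contraTneq szq => ->.
by rewrite size_polyC -leqNgt leq_b1.
Qed.

Lemma size_subC q c : (1 < size q)%N -> size (q - c%:P) = size q.
Proof.
move=> szq; rewrite size_polyDl // size_polyN size_polyC.
exact: leq_ltn_trans (leq_b1 _) szq.
Qed.

Lemma root_subC q c z : root (q - c%:P) z = (q.[z] == c).
Proof. by rewrite rootE !hornerE subr_eq0. Qed.

Lemma ram_gt0 q z : (1 < size q)%N -> (0 < ram q z)%N.
Proof. by move=> szq; rewrite mup_gt0 ?subC_neq0 // root_subC. Qed.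

Lemma mup_subC q c z : (1 < size q)%N ->
  mup z (q - c%:P) = (if q.[z] == c then ram q z else 0)%N.
Proof.
move=> szq; case: eqP => [<- //|/eqP neq_c].
by rewrite mupNroot // root_subC.
Qed.

Lemma mup_comp Q h z : Q != 0 -> (1 < size h)%N ->
  mup z (Q \Po h) = (mup h.[z] Q * ram h z)%N.
Proof.
move=> Q_neq0 szh; rewrite (mup_zeros _ Q_neq0) {1}(zerosE Q).
rewrite comp_polyZ -mul_polyC mupMr ?rootC ?lead_coef_eq0 //.
elim: (zeros Q) => [|a r IHr] /=.
  by rewrite big_nil comp_polyC mul0n mupNroot // rootC oner_neq0.
rewrite big_cons comp_polyM comp_polyB comp_polyX comp_polyC mupM ?subC_neq0 //.
  by rewrite IHr mup_subC // eq_sym mulnDl; case: eqP; rewrite ?mul1n.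
rewrite -lead_coef_eq0 lead_coef_comp // mulf_neq0 ?expf_neq0 ?lead_coef_eq0 //.
  by rewrite monic_neq0 ?monic_prod_XsubC.
by rewrite -size_poly_gt0 ltnW.
Qed.

Lemma ram_comp g h z : (1 < size g)%N -> (1 < size h)%N ->
  ram (g \Po h) z = (ram g h.[z] * ram h z)%N.
Proof.
move=> szg szh; rewrite -mup_comp ?subC_neq0 // /ram.
by rewrite comp_polyB comp_polyC horner_comp.
Qed.

(** Tameness is the hypothesis that the index [e] is nonzero in [K]: it keeps the term
    [e u (x - z)^(e - 1)] of the derivative from vanishing. *)
Lemma mup_deriv q z : (1 < size q)%N -> (ram q z)%:R != 0 :> K ->
  mup z q^`() = (ram q z).-1.
Proof.
move=> szq; have q0 := subC_neq0 q.[z] szq; have e_gt0 := ram_gt0 z szq.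
have /dvdpP [u uE] : ('X - z%:P) ^+ ram q z %| q - q.[z]%:P by rewrite -mup_geq.
have u0 : ~~ root u z.
  apply/negP => /factor_theorem [v vE].
  have : ((ram q z).+1 <= mup z (q - q.[z]%:P))%N.
    by rewrite mup_geq // uE vE -mulrA -exprS dvdp_mull.
  by rewrite ltnn.
have -> : q^`() = (q - q.[z]%:P)^`() by rewrite derivB derivC subr0.
rewrite uE; case: (ram q z) e_gt0 => //= e _ e_neq0.
rewrite derivM deriv_exp derivXsubC mul1r /=.
rewrite exprS mulrA mulrnAr -mulrnAl -mulrDl mupMr ?mup_XsubCX ?eqxx //.
rewrite rootE !hornerE hornerMn subrr mulr0 add0r -mulr_natr mulf_eq0 negb_or.
by rewrite e_neq0 andbT.
Qed.

Definition fiber q c : seq K := undup (zeros (q - c%:P)).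

Lemma fiber_uniq q c : uniq (fiber q c).
Proof. exact: undup_uniq. Qed.

Lemma mem_fiber q c z : (1 < size q)%N -> (z \in fiber q c) = (q.[z] == c).
Proof. by move=> szq; rewrite mem_undup mem_zeros ?subC_neq0 // root_subC. Qed.

Lemma uniq_fibers q s : (1 < size q)%N -> uniq s ->
  uniq (flatten [seq fiber q c | c <- s]).
Proof.
move=> szq; elim: s => //= c s IHs /andP[c_s s_uniq].
rewrite cat_uniq fiber_uniq IHs // andbT; apply/hasPn => z /flatten_mapP[y y_s].
rewrite !mem_fiber // => /eqP ->; apply: contraNN c_s => /eqP <-.
exact: y_s.
Qed.

Lemma sum_ram q c : (1 < size q)%N ->
  (\sum_(z <- fiber q c) ram q z = (size q).-1)%N.
Proof.
move=> szq; rewrite -(size_subC c szq) -(sum_mup (subC_neq0 c szq) (fiber_uniq q c)).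
  by apply: eq_big_seq => z; rewrite mem_fiber // mup_subC // => ->.
by move=> z; rewrite mem_fiber // root_subC.
Qed.
End Ramification.

(** * Multiplicities over a critical value *)
(** Stated over any field so that it passes from [F] to the closure. Nonvanishing of [f'] bounds all
    multiplicities below [p], see [ram_lt]; the constant terms ensure that [hs - h] is not
    constant. *)
Record tame_collision (F : fieldType) (p : nat) (g h gs hs : {poly F}) : Prop :=
  TameCollision {
    tc_g : g \is monic; tc_h : h \is monic;
    tc_gs : gs \is monic; tc_hs : hs \is monic;
    tc_szg : size g = p.+1; tc_szh : size h = p.+1;
    tc_szgs : size gs = p.+1; tc_szhs : size hs = p.+1;
    tc_h0 : h`_0 = 0; tc_hs0 : hs`_0 = 0;
    tc_neq : h != hs; tc_comp : g \Po h = gs \Po hs;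
    tc_deriv : (g \Po h)^`() != 0 }.

Lemma tame_collision_sym (F : fieldType) p (g h gs hs : {poly F}) :
  tame_collision p g h gs hs -> tame_collision p gs hs g h.
Proof.
case=> *; split=> //; first by rewrite eq_sym.
by match goal with E : g \Po h = _ |- _ => rewrite -E end.
Qed.

Section SumPred.
Local Open Scope nat_scope.

Lemma sum_predn (T : eqType) (s : seq T) (n : T -> nat) :
  (forall z, z \in s -> 0 < n z) ->
  (\sum_(z <- s) (n z).-1) + size s = \sum_(z <- s) n z.
Proof.
move=> n_gt0; rewrite -sum1_size -big_split /=.
by apply: eq_big_seq => z /n_gt0 nz; rewrite addn1 prednK.
Qed.

Lemma size_mul_le_sum (T : eqType) (s : seq T) (n : T -> nat) k :
  (forall z, z \in s -> k <= n z) -> k * size s <= \sum_(z <- s) n z.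
Proof.
move=> k_le; rewrite -sum1_size big_distrr /= big_seq [leqRHS]big_seq.
by apply: leq_sum => z /k_le; rewrite muln1.
Qed.
End SumPred.

Section LocalCounting.
Variables (K : closedFieldType) (p : nat) (g h gs hs : {poly K}).
Hypotheses (charKp : p \in [pchar K]) (C : tame_collision p g h gs hs).

Let p_pr : prime p := pcharf_prime charKp.

Lemma tc_gt1 :
  [/\ (1 < size g)%N, (1 < size h)%N, (1 < size gs)%N & (1 < size hs)%N].
Proof.
by case: C => ? ? ? ? -> -> -> -> *; rewrite ltnS prime_gt0.
Qed.

Lemma tc_deriv_neq0 :
  [/\ g^`() != 0, h^`() != 0, gs^`() != 0 & hs^`() != 0].
Proof.
have df := tc_deriv C; have dfs := df; rewrite (tc_comp C) in dfs.
rewrite deriv_comp mulf_eq0 negb_or in df; rewrite deriv_comp mulf_eq0 negb_or in dfs.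
move: df dfs => /andP[dg dh] /andP[dgs dhs]; split=> //.
  by apply: contraNneq dg => ->; rewrite comp_poly0.
by apply: contraNneq dgs => ->; rewrite comp_poly0.
Qed.

Lemma ram_lt (q : {poly K}) z : q \is monic -> size q = p.+1 -> q^`() != 0 -> (ram q z < p)%N.
Proof.
move=> q_monic szq dq; have q_gt1 : (1 < size q)%N by rewrite szq ltnS prime_gt0.
have q0 := subC_neq0 q.[z] q_gt1.
have le_p : (ram q z <= p)%N.
  have := sum_mup_le (s := [:: z]) q0 isT.
  by rewrite big_seq1 size_subC // szq.
rewrite ltn_neqAle le_p andbT; apply: contraNneq dq => ram_p.
have /dvdpP [u uE] : ('X - z%:P) ^+ p %| q - q.[z]%:P by rewrite -mup_geq // -/(ram q z) ram_p.
have u0 : u != 0 by apply: contra_eq_neq uE => ->; rewrite mul0r.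
have : size u = 1%N.
  have := congr1 (fun P : {poly K} => size P) uE.
  rewrite /= size_subC // szq size_Mmonic ?rpredX ?monicXsubC // size_exp_XsubC.
  by rewrite addnS /= -[p.+1]add1n => /addIn.
move=> szu; have uC : u = (u`_0)%:P by apply: size1_polyC; rewrite szu.
have -> : q^`() = (q - q.[z]%:P)^`() by rewrite derivB derivC subr0.
rewrite uE uC derivM deriv_exp derivC derivXsubC mul0r add0r -mulr_natr -polyC_natr.
by rewrite (pcharf0 charKp) mulr0 mulr0.
Qed.

Lemma ram_balance z :
  (ram g h.[z] * ram h z = ram gs hs.[z] * ram hs z)%N.
Proof. by have [? ? ? ?] := tc_gt1; rewrite -!ram_comp // (tc_comp C). Qed.

(** [fiber_poly] factors [gs - g(a)] over the zeros of [h - a]; the multiplicity of the root [b]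
    counts the zeros that [hs] sends to [b]. *)
Lemma sum_ram_over a b s : uniq s -> g.[a] = gs.[b] ->
  (forall z, (z \in s) = (h.[z] == a) && (hs.[z] == b)) ->
  (\sum_(z <- s) ram h z = ram gs b)%N.
Proof.
move=> s_uniq gab memE; have [g1 h1 gs1 hs1] := tc_gt1.
set r := zeros (h - a%:P).
have h_monic : h - a%:P \is monic.
  rewrite monicE lead_coefDl -?monicE ?(tc_h C) // size_polyN size_polyC.
  exact: leq_ltn_trans (leq_b1 _) h1.
have szd : (1 < size (hs - h)%R <= p)%N.
  apply/andP; split; last first.
    by apply: size_monicB (tc_hs C) (tc_h C) (tc_szhs C) (tc_szh C).
  rewrite ltnNge; apply/negP => /size1_polyC dC.
  have := tc_neq C; rewrite eq_sym -subr_eq0 dC coefB (tc_h0 C) (tc_hs0 C).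
  by rewrite subrr eqxx.
have fE := fiber_poly p_pr (tc_g C) (tc_szg C) (tc_gs C) (tc_szgs C) (tc_szh C)
  szd (tc_comp C) (zeros_monic h_monic).
rewrite -/r gab in fE.
rewrite /ram fE -(big_map (fun z => hs.[z]) xpredT (fun y => 'X - y%:P)).
rewrite mu_prod_XsubC count_map.
rewrite [LHS](_ : _ = \sum_(z <- s) count_mem z r)%N; last first.
  apply: eq_big_seq => z; rewrite memE => /andP[/eqP hz _].
  by rewrite /ram hz mup_zeros ?subC_neq0.
rewrite sum_count_mem //; apply: eq_in_count => z.
by rewrite mem_zeros ?subC_neq0 // root_subC memE /= => ->.
Qed.

(** The points that the parametrisation [(h, hs)] of the curve [g(x) = gs(y)] sends to [(a, b)]. *)
Definition over a b := [seq z <- fiber hs b | h.[z] == a].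

Lemma over_uniq a b : uniq (over a b).
Proof. exact: filter_uniq (fiber_uniq _ _). Qed.

Lemma mem_over a b z : (z \in over a b) = (h.[z] == a) && (hs.[z] == b).
Proof. by have [? ? ? ?] := tc_gt1; rewrite mem_filter mem_fiber. Qed.

Lemma over_excess a b : g.[a] = gs.[b] ->
  ((\sum_(z <- over a b) (ram h z).-1) + size (over a b) = ram gs b)%N.
Proof.
move=> gab; have [? ? ? ?] := tc_gt1.
rewrite sum_predn => [|z _]; last exact: ram_gt0.
exact: sum_ram_over (over_uniq _ _) gab (mem_over _ _).
Qed.

(** By [ram_balance] and coprimality, [ram gs b] divides each [ram h z] above [(a, b)]. These
    indices add up to [ram gs b], so there is one point, and it carries the whole index. *)
Lemma excess_coprime a b : g.[a] = gs.[b] -> coprime (ram g a) (ram gs b) ->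
  ((ram gs b).-1 <= \sum_(z <- over a b) (ram h z).-1)%N.
Proof.
move=> gab cop; have [? ? ? ?] := tc_gt1; have e_gt0 := ram_gt0 b (_ : 1 < size gs)%N.
have sz_le1 : (size (over a b) <= 1)%N.
  have := sum_ram_over (over_uniq a b) gab (mem_over a b).
  have /size_mul_le_sum : forall z, z \in over a b -> (ram gs b <= ram h z)%N.
    move=> z; rewrite mem_over => /andP[/eqP hz /eqP hsz].
    apply: dvdn_leq; rewrite ?ram_gt0 //.
    rewrite -(Gauss_dvdr _ (_ : coprime _ (ram g a))) ?(coprime_sym (ram gs b)) //.
    by rewrite -hz ram_balance hsz dvdn_mulr.
  by move=> + eq_e; rewrite eq_e -{2}[ram gs b]muln1 leq_pmul2l // e_gt0.
have := over_excess gab; move: sz_le1.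
by move: (ram gs b) (\sum_(z <- _) _)%N (size _); clear; lia.
Qed.

(** A point with [ram h z = 1] would make [ram gs b] divide [ram g a]. Hence all indices are at
    least [2], there are at most [ram gs b / 2] points, and at least half of the index is excess. *)
Lemma excess_ndvd a b : g.[a] = gs.[b] -> ~~ (ram gs b %| ram g a)%N ->
  (ram gs b <= (\sum_(z <- over a b) (ram h z).-1).*2)%N.
Proof.
move=> gab ndvd; have [? ? ? ?] := tc_gt1.
have szle : (2 * size (over a b) <= ram gs b)%N.
  rewrite -(sum_ram_over (over_uniq a b) gab (mem_over a b)).
  apply: size_mul_le_sum => z; rewrite mem_over => /andP[/eqP hz /eqP hsz].
  rewrite ltn_neqAle ram_gt0 // andbT; apply: contraNneq ndvd => ram1.
  by rewrite -hz -[ram g _]muln1 ram1 ram_balance hsz dvdn_mulr.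
have := over_excess gab; move: szle.
by move: (ram gs b) (\sum_(z <- _) _)%N (size _); clear; lia.
Qed.

Lemma fiber_excessE b :
  (\sum_(z <- fiber hs b) (ram h z).-1 =
   \sum_(a <- fiber g gs.[b]) \sum_(z <- over a b) (ram h z).-1)%N.
Proof.
have [? ? ? ?] := tc_gt1.
under [RHS]eq_bigr do rewrite big_filter big_mkcond.
rewrite exchange_big /=; apply: eq_big_seq => z; rewrite mem_fiber // => /eqP hsz.
have hz_in : h.[z] \in fiber g gs.[b].
  by rewrite mem_fiber // -horner_comp (tc_comp C) horner_comp hsz.
rewrite (bigD1_seq _ hz_in (fiber_uniq _ _)) /= eqxx big1 ?addn0 // => a a_neq.
by rewrite eq_sym (negPf a_neq).
Qed.

Let ndvd b a := ~~ (ram gs b %| ram g a)%N.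

Lemma ramified_ndvd b : (1 < ram gs b)%N -> has (ndvd b) (fiber g gs.[b]).
Proof.
move=> e_gt1; have [? ? ? ?] := tc_gt1; have [dg _ dgs _] := tc_deriv_neq0.
rewrite has_predC; apply/allP => /= all_dvd.
have : (ram gs b %| p)%N.
  rewrite -[p]/p.+1.-1 -(tc_szg C) -(sum_ram gs.[b]) // big_seq.
  by apply: (big_ind (fun n => ram gs b %| n)%N) => // x y; apply: dvdn_add.
have /primeP[_ /[apply]/orP[/eqP e1|/eqP ep]] := p_pr; first by rewrite e1 in e_gt1.
by have := ram_lt b (tc_gs C) (tc_szgs C) dgs; rewrite ep ltnn.
Qed.

(** Let [e = ram gs b > 1]. Two points of the fibre of [g] whose multiplicities are not divisible by
    [e] already give excess [e], by [excess_ndvd]. If there is only one, its multiplicity is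
    congruent to [p] mod [e], hence prime to [e], and [excess_coprime] gives [e - 1]. There is at
    least one by [ramified_ndvd]. *)
Lemma fiber_excess b :
  ((ram gs b).-1 <= \sum_(z <- fiber hs b) (ram h z).-1)%N /\
  ((1 < ram gs b)%N -> (\sum_(z <- fiber hs b) (ram h z).-1 < ram gs b)%N ->
     count (ndvd b) (fiber g gs.[b]) = 1%N).
Proof.
have [? ? ? ?] := tc_gt1; have [dg _ dgs _] := tc_deriv_neq0.
have [e_gt1|] := ltnP 1 (ram gs b); last by case: (ram gs b) => [|[]].
set A := fiber g gs.[b]; set e := ram gs b in e_gt1 *.
have A_img a : a \in A -> g.[a] = gs.[b] by rewrite mem_fiber // => /eqP.
have le2 : (count (ndvd b) A * e <= (\sum_(z <- fiber hs b) (ram h z).-1).*2)%N.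
  rewrite fiber_excessE -/A -mul2n big_distrr /= -sum1_count big_distrl /= big_mkcond.
  rewrite big_seq [leqRHS]big_seq; apply: leq_sum => a /A_img ga.
  by case: ifP => // nd; rewrite mul1n mul2n; apply: excess_ndvd.
have cnt_gt0 : (0 < count (ndvd b) A)%N by rewrite -has_count ramified_ndvd.
case cntE: (count (ndvd b) A) cnt_gt0 le2 => [|[|k]] // _ le2; last first.
  move: le2 e_gt1; move: (\sum_(z <- _) _)%N; clear; nia.
split=> // {le2}.
have szF : size (filter (ndvd b) A) = 1%N by rewrite size_filter.
case FE: (filter (ndvd b) A) szF => [|a0 [|]] // _.
have /andP[nd_a0 a0_A] : ndvd b a0 && (a0 \in A).
  by rewrite -mem_filter FE mem_head.
have [k kE] : exists k, p = (k * e + ram g a0)%N.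
  have /dvdnP[k kE] : (e %| \sum_(a <- A | ~~ ndvd b a) ram g a)%N.
    apply: (big_ind (fun n => e %| n)%N) => // [x y|a]; first exact: dvdn_add.
    by rewrite negbK.
  exists k; rewrite -kE addnC -[p]/p.+1.-1 -(tc_szg C) -(sum_ram gs.[b]) //.
  by rewrite (bigID (ndvd b)) -big_filter -/A FE big_seq1.
have cop : coprime (ram g a0) e.
  rewrite coprime_sym /coprime -(gcdnMDl k) -kE -/(coprime _ _) coprime_sym.
  rewrite prime_coprime // gtnNdvd ?(ltnW e_gt1) //.
  exact: ram_lt (tc_gs C) (tc_szgs C) dgs.
apply: leq_trans (excess_coprime (A_img _ a0_A) cop) _.
by rewrite fiber_excessE (bigD1_seq _ a0_A (fiber_uniq _ _)) /= leq_addr.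
Qed.

(* Both sides of the fibrewise inequality [fiber_excess] have the same total
   over all fibres, namely [deg gs' = deg h'], so it is an equality. *)
Lemma ramified_fiber b : (1 < ram gs b)%N ->
  count (ndvd b) (fiber g gs.[b]) = 1%N.
Proof.
move=> e_gt1; have [g1 h1 gs1 hs1] := tc_gt1; have [dg dh dgs dhs] := tc_deriv_neq0.
apply: (fiber_excess b).2 => //; rewrite ltnNge; apply/negP => X_ge.
have e_gt0 := ltnW e_gt1.
pose X y := (\sum_(z <- fiber hs y) (ram h z).-1)%N.
(* [L] contains all zeros of [gs'], so it carries the full degree of [gs'], while the excess of [h]
   over [L] is at most [deg h']. An excess beyond [e - 1] at [b] alone would contradict the equality
   of these degrees. *)
pose L := undup (b :: zeros gs^`()).
have b_L : b \in L by rewrite mem_undup mem_head.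
have L_uniq : uniq L := undup_uniq _.
have ram_neq0 (q : {poly K}) z : q \is monic -> size q = p.+1 -> q^`() != 0 ->
    (ram q z)%:R != 0 :> K.
  move=> q_m szq dq; rewrite (natf_neq0_lt charKp) // ram_lt // andbT ram_gt0 //.
  by rewrite szq ltnS prime_gt0.
have sumL : (\sum_(y <- L) (ram gs y).-1 = (size gs^`()).-1)%N.
  rewrite -(sum_mup dgs L_uniq) => [|z z_root]; last first.
    by rewrite mem_undup inE mem_zeros // z_root orbT.
  by apply: eq_bigr => y _; rewrite mup_deriv // ram_neq0 // ?(tc_gs C) ?(tc_szgs C).
have sumX : (\sum_(y <- L) X y <= (size h^`()).-1)%N.
  pose W := flatten [seq fiber hs y | y <- L].
  have W_uniq : uniq W := uniq_fibers hs1 L_uniq.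
  have := sum_mup_le dh W_uniq; rewrite /W big_flatten big_map.
  apply: leq_trans; apply: leq_sum => y _; apply: leq_sum => z _.
  by rewrite mup_deriv // ram_neq0 // ?(tc_h C) ?(tc_szh C).
have [eqg eqh eqd] := size_deriv_collision charKp (tc_g C) (tc_h C) (tc_gs C)
  (tc_hs C) (tc_szg C) (tc_szh C) (tc_szgs C) (tc_szhs C) (tc_h0 C) (tc_hs0 C)
  (tc_neq C) (tc_comp C) (tc_deriv C).
move: sumX; rewrite eqh -eqd eqg -sumL leqNgt => /negP; apply.
rewrite (bigD1_seq b) // [ltnRHS](bigD1_seq b) //=.
rewrite -addSn leq_add ?prednK //.
by apply: leq_sum => y _; have [] := fiber_excess y.
Qed.
End LocalCounting.

(** * Combinatorics of two lists of multiplicities with prime sum *)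

Section Combinatorics.
Local Open Scope nat_scope.
Implicit Types (S T : eqType).

Definition simple_type S T (A : seq S) (B : seq T) (e : S -> nat) (f : T -> nat) p :=
  exists M a0 b0, [/\ 1 < M, [/\ a0 \in A, b0 \in B, e a0 = 1 & f b0 = 1],
    forall a, a \in A -> a != a0 -> e a = M,
    forall b, b \in B -> b != b0 -> f b = M
  & (M * (size A).-1).+1 = p /\ (M * (size B).-1).+1 = p].

(** The labels are crossed: the multiplicities at [a1], [b1] and at [a2], [b2] are coprime, those at
    [a1], [b2] and at [a2], [b1] are equal. The normal form is built from these two kinds of
    pairs. *)
Definition multiple_type S T (A : seq S) (B : seq T) (e : S -> nat) (f : T -> nat) p :=
  exists m a1 a2 b1 b2,
  [/\ 1 < m < p.-1, a1 != a2 /\ b1 != b2,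
     [/\ e a1 = m, e a2 = p - m, f b1 = p - m & f b2 = m],
     forall a, (a \in A) = (a == a1) || (a == a2)
   & forall b, (b \in B) = (b == b1) || (b == b2)].

Lemma count1_witness S (P : pred S) (A : seq S) : count P A = 1 ->
  exists a0, [/\ a0 \in A, P a0 & forall a, a \in A -> a != a0 -> ~~ P a].
Proof.
rewrite -size_filter; case FE: (filter P A) => [|a0 [|]] // _; exists a0.
have mem_F a : (P a && (a \in A)) = (a == a0) by rewrite -mem_filter FE inE.
have /andP[Pa0 a0A] : P a0 && (a0 \in A) by rewrite mem_F.
split=> // a aA; apply: contraNN => Pa; by rewrite -mem_F Pa aA.
Qed.

Section Fiber.
Variables (S T : eqType) (A : seq S) (B : seq T).
Variables (e : S -> nat) (f : T -> nat) (p : nat).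
Hypotheses (p_pr : prime p) (A_uniq : uniq A) (B_uniq : uniq B).
Hypotheses (e_bound : forall a, 0 < e a < p) (f_bound : forall b, 0 < f b < p).
Hypotheses (sum_e : \sum_(a <- A) e a = p) (sum_f : \sum_(b <- B) f b = p).
Hypothesis e_exception : forall b, b \in B -> 1 < f b ->
  count (fun a => ~~ (f b %| e a)) A = 1.
Hypothesis f_exception : forall a, a \in A -> 1 < e a ->
  count (fun b => ~~ (e a %| f b)) B = 1.

Lemma one_exception (U : eqType) (D : seq U) (n : U -> nat) M : uniq D ->
  (forall u, 0 < n u < p) -> \sum_(u <- D) n u = p ->
  (forall u, u \in D -> n u <= M) -> count (fun u => ~~ (M %| n u)) D = 1 ->
  exists u0, [/\ u0 \in D, n u0 < M, forall u, u \in D -> u != u0 -> n u = M,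
                 p = M * (size D).-1 + n u0 & 1 < size D].
Proof.
move=> D_uniq n_bound sum_n n_le /count1_witness[u0 [u0D nd_u0 dvd_n]].
have nE u : u \in D -> u != u0 -> n u = M.
  move=> uD /(dvd_n u uD); rewrite negbK => /dvdn_leq M_le.
  by apply/eqP; rewrite eqn_leq n_le //= M_le //; case/andP: (n_bound u).
have sumE : p = M * (size D).-1 + n u0.
  rewrite -sum_n (bigD1_seq u0) //= addnC; congr (_ + _).
  rewrite big_seq_cond (eq_bigr (fun=> M)) => [|u /andP[uD]]; last exact: nE.
  rewrite -big_seq_cond big_const_seq iter_addn_0; congr (_ * _).
  by rewrite -(count_predC (pred1 u0)) count_uniq_mem // u0D.
exists u0; split=> //.
  by rewrite ltn_neqAle n_le // andbT; apply: contraNneq nd_u0 => ->.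
case: (size D) sumE => [|[|]] //=; rewrite muln0 add0n => pE;
  by have := n_bound u0; rewrite -pE ltnn andbF.
Qed.

(* For [M] the largest multiplicity, exactly one multiplicity on the other side
   is not divisible by [M], hence all but one equal [M] on both sides. *)
Lemma fiber_type_max a : a \in A -> 1 < e a ->
  (forall a', a' \in A -> e a' <= e a) -> (forall b, b \in B -> f b <= e a) ->
  simple_type A B e f p \/ multiple_type A B e f p.
Proof.
move=> aA; set M := e a => M_gt1 e_le f_le.
have [b0 [b0B f_b0 fE pfE szB]] := one_exception B_uniq f_bound sum_f f_le (f_exception aA M_gt1).
have [b1 [b1B b10]] : exists b1, b1 \in B /\ b1 != b0.
  have : has (predC1 b0) B.
    rewrite has_predC; apply/negP => /all_pred1P B_const.
    by move: B_uniq szB; rewrite B_const; case: (size B) => [|[|n]] //=; rewrite inE eqxx.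
  by case/hasP => b1; exists b1.
have fb1 : f b1 = M by exact: fE.
have [a0 [a0A e_a0 eE peE szA]] : exists u0,
  [/\ u0 \in A, e u0 < M, forall u, u \in A -> u != u0 -> e u = M,
      p = M * (size A).-1 + e u0 & 1 < size A].
  apply: one_exception => //; rewrite -fb1; apply: e_exception; rewrite ?fb1 //.
(* Both exceptional multiplicities are the residue of [p] mod [M]. *)
have r_eq : f b0 = e a0.
  by rewrite -(modn_small f_b0) -(modn_small e_a0) -(modnMDl (size B).-1)
    -(modnMDl (size A).-1 (e a0)) ![_.-1 * M]mulnC -pfE -peE.
have sz_eq : size A = size B.
  have : M * (size A).-1 = M * (size B).-1.
    by apply: (@addIn (e a0)); rewrite -peE -{1}r_eq -pfE.
  move/eqP; rewrite eqn_pmul2l ?(ltnW M_gt1) // => /eqP.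
  by move: szA szB; clear; lia.
have [r1|r_neq1] := eqVneq (e a0) 1.
  left; exists M, a0, b0; split=> //; first by rewrite r_eq.
  by rewrite -sz_eq; split; rewrite -addn1 -[X in _ + X]r1 -peE.
right.
(* For [r = e a0 > 1], [r] does not divide [M], as it would then divide [p]. So every point of [B]
   other than [b0] is an exception for [r], and [B] has two points. *)
have r_gt1 : 1 < e a0 by rewrite ltn_neqAle eq_sym r_neq1; case/andP: (e_bound a0).
have r_ndvd : ~~ (e a0 %| M).
  apply/negP => r_dvd; have : e a0 %| p by rewrite peE dvdn_add // dvdn_mulr.
  have /primeP[_ /[apply]/orP[/eqP|/eqP]] := p_pr; first by move/eqP: r_neq1.
  by move=> ep; have := e_bound a0; rewrite ep ltnn andbF.
have szB2 : size B = 2.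
  have := f_exception a0A r_gt1.
  rewrite (@eq_in_count _ _ (predC1 b0)); last first.
    move=> b bB /=; case: eqVneq => [->|b_neq]; first by rewrite r_eq dvdnn.
    by rewrite fE // r_ndvd.
  have := count_predC (pred1 b0) B; rewrite count_uniq_mem // b0B /= => <-.
  by move=> ->.
have MpE : e a0 = p - M by rewrite peE sz_eq szB2 muln1 addKn.
have M_lt : M < p by have := e_bound a => /andP[].
have [a1 [a1A a10]] : exists a1, a1 \in A /\ a1 != a0.
  by exists a; split=> //; apply: contraTneq e_a0 => <-; rewrite ltnn.
have two (U : eqType) (D : seq U) u v : uniq D -> size D = 2 -> u \in D -> v \in D ->
    u != v -> forall w, (w \in D) = (w == u) || (w == v).
  case: D => [|x [|y []]] //= ; rewrite !inE andbT => xy _ ux vx uv w.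
  rewrite !inE; move: ux vx uv.
  by do 2![case/orP=> /eqP ->]; rewrite ?eqxx // orbC.
exists M, a1, a0, b0, b1; split.
- by rewrite M_gt1 /=; move: MpE r_gt1 M_lt; clear; lia.
- by rewrite a10 eq_sym.
- by rewrite eE // r_eq.
- by apply: two; rewrite ?sz_eq.
- by apply: two; rewrite // eq_sym.
Qed.
End Fiber.

Lemma simple_type_sym S T (A : seq S) (B : seq T) e f p :
  simple_type A B e f p -> simple_type B A f e p.
Proof. by case=> M [a0 [b0 [? [? ? ? ?] ? ? [? ?]]]]; exists M, b0, a0. Qed.

Lemma multiple_type_sym S T (A : seq S) (B : seq T) e f p :
  multiple_type A B e f p -> multiple_type B A f e p.
Proof.
case=> m [a1 [a2 [b1 [b2 [m_lt [? ?] [? ? ? ?] ? ?]]]]].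
have mK : p - (p - m) = m by rewrite subKn //; move: m_lt; clear; lia.
exists (p - m), b1, b2, a1, a2; split=> //; last by split=> //; rewrite mK.
by move: m_lt; clear; lia.
Qed.

Lemma fiber_type S T (A : seq S) (B : seq T) e f p : prime p -> uniq A -> uniq B ->
  (forall a, 0 < e a < p) -> (forall b, 0 < f b < p) ->
  \sum_(a <- A) e a = p -> \sum_(b <- B) f b = p ->
  (forall b, b \in B -> 1 < f b -> count (fun a => ~~ (f b %| e a)) A = 1) ->
  (forall a, a \in A -> 1 < e a -> count (fun b => ~~ (e a %| f b)) B = 1) ->
  has (fun a => 1 < e a) A || has (fun b => 1 < f b) B ->
  simple_type A B e f p \/ multiple_type A B e f p.
Proof.
move=> p_pr A_uniq B_uniq e_b f_b sum_e sum_f e_exc f_exc ramified.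
have max_exists (U : eqType) (D : seq U) (n : U -> nat) : D != [::] ->
    exists2 u, u \in D & forall v, v \in D -> n v <= n u.
  elim: D => // x [|y D] IH _.
    by exists x; rewrite ?mem_head // => v; rewrite inE => /eqP ->.
  have [//|u uD u_max] := IH; have [le_xu|lt_ux] := leqP (n x) (n u).
    by exists u; [rewrite inE uD orbT|move=> v; rewrite inE => /predU1P[->|/u_max]].
  exists x; rewrite ?mem_head // => v; rewrite inE => /predU1P[-> //|/u_max].
  by move/leq_trans; apply; apply: ltnW.
have p_gt0 := prime_gt0 p_pr.
have [a aA a_max] : exists2 u, u \in A & forall v, v \in A -> e v <= e u.
  by apply: max_exists; apply: contraTneq p_gt0 => A0; rewrite -sum_e A0 big_nil.
have [b bB b_max] : exists2 u, u \in B & forall v, v \in B -> f v <= f u.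
  by apply: max_exists; apply: contraTneq p_gt0 => B0; rewrite -sum_f B0 big_nil.
have max_gt1 : (1 < e a) || (1 < f b).
  case/orP: ramified => /hasP[u uD u_gt1].
    by rewrite (leq_trans u_gt1 (a_max u uD)).
  by rewrite (leq_trans u_gt1 (b_max u uD)) orbT.
have [le_fe|lt_ef] := leqP (f b) (e a).
  apply: (@fiber_type_max _ _ _ _ _ _ _ _ _ _ _ _ _ _ _ _ a) => //.
    by case/orP: max_gt1 => // /leq_trans; apply.
  by move=> b' /b_max /leq_trans; apply.
suff [/simple_type_sym|/multiple_type_sym] :
  simple_type B A f e p \/ multiple_type B A f e p by [left|right].
apply: (@fiber_type_max _ _ _ _ _ _ _ _ _ _ _ _ _ _ _ _ b) => //.
  by case/orP: max_gt1 => // /leq_trans; apply; apply: ltnW.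
by move=> a' /a_max /leq_trans; apply; apply: ltnW.
Qed.
End Combinatorics.

(** * Critical values and simple points *)

Section CriticalValues.
Variables (K : closedFieldType) (p : nat) (g h gs hs : {poly K}).
Hypotheses (charKp : p \in [pchar K]) (C : tame_collision p g h gs hs).

Let p_pr : prime p := pcharf_prime charKp.

Definition simple_value c :=
  simple_type (fiber g c) (fiber gs c) (ram g) (ram gs) p.
Definition multiple_value c :=
  multiple_type (fiber g c) (fiber gs c) (ram g) (ram gs) p.
Definition critical c :=
  has (fun a => 1 < ram g a)%N (fiber g c) || has (fun b => 1 < ram gs b)%N (fiber gs c).

Lemma ram_bound :
  [/\ forall z, (0 < ram g z < p)%N, forall z, (0 < ram h z < p)%N,
      forall z, (0 < ram gs z < p)%N & forall z, (0 < ram hs z < p)%N].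
Proof.
have [? ? ? ?] := tc_gt1 charKp C; have [? ? ? ?] := tc_deriv_neq0 C.
by case: C => ? ? ? ? ? ? ? ? *; split=> z; rewrite ram_gt0 // (ram_lt charKp).
Qed.

Lemma critical_type c : critical c -> simple_value c \/ multiple_value c.
Proof.
have [g1 h1 gs1 hs1] := tc_gt1 charKp C; have [gb _ gsb _] := ram_bound.
have Cs := tame_collision_sym C.
apply: fiber_type; rewrite ?fiber_uniq //.
- by rewrite sum_ram // (tc_szg C).
- by rewrite sum_ram // (tc_szgs C).
- move=> b; rewrite mem_fiber // => /eqP <-; exact: (ramified_fiber charKp C).
- move=> a; rewrite mem_fiber // => /eqP <-; exact: (ramified_fiber charKp Cs).
Qed.

Lemma size_deriv_le (q : {poly K}) : q \is monic -> size q = p.+1 -> q^`() != 0 ->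
  (size q^`() < p)%N.
Proof.
move=> q_m szq dq; have [/andP[_ le_p] szd _] := size_deriv_subXp charKp q_m szq dq.
by rewrite szd.
Qed.

Lemma size_fiber_le c : simple_value c \/ multiple_value c ->
  ((size (fiber g c)).*2 <= p.+1)%N /\ ((size (fiber gs c)).*2 <= p.+1)%N.
Proof.
case=> [[M [a0 [b0 [M_gt1 _ _ _ [eA eB]]]]]|].
  have sz n : ((M * n.-1).+1 = p -> n.*2 <= p.+1)%N.
    by move=> <-; move: M_gt1; clear; nia.
  by rewrite !sz.
case=> m [a1 [a2 [b1 [b2 [m_lt _ _ memA memB]]]]].
have sz2 (D : seq K) u v : uniq D -> (forall z, (z \in D) = (z == u) || (z == v)) ->
    (size D <= 2)%N.
  move=> D_uniq memD; rewrite -[2%N]/(size [:: u; v]); apply: uniq_leq_size => // z.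
  by rewrite memD !inE.
have := sz2 _ _ _ (fiber_uniq _ _) memA; have := sz2 _ _ _ (fiber_uniq _ _) memB.
by move: m_lt; move: (size (fiber g c)) (size (fiber gs c)); clear; lia.
Qed.

Lemma sum_ram_pred (q : {poly K}) c : (1 < size q)%N -> size q = p.+1 ->
  ((\sum_(z <- fiber q c) (ram q z).-1) + size (fiber q c) = p)%N.
Proof.
move=> q1 szq; rewrite sum_predn => [|z _]; last exact: ram_gt0.
by rewrite sum_ram // szq.
Qed.

Lemma mup_deriv_ram (q : {poly K}) z : (1 < size q)%N -> (0 < ram q z < p)%N ->
  mup z q^`() = (ram q z).-1.
Proof. by move=> q1 rb; rewrite mup_deriv // (natf_neq0_lt charKp). Qed.

(* Each critical value uses up at least [(p - 1) / 2] of the at most [p - 2]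
   zeros of [g'], so there is at most one. *)
Lemma size_deriv_critical c : critical c ->
  ((size g^`()).-1 + size (fiber g c) = p)%N.
Proof.
move=> c_crit; have [g1 h1 gs1 hs1] := tc_gt1 charKp C.
have [gb _ _ _] := ram_bound; have [dg _ _ _] := tc_deriv_neq0 C.
have sumE c' : (\sum_(z <- fiber g c') mup z g^`() =
    \sum_(z <- fiber g c') (ram g z).-1)%N.
  by apply: eq_bigr => z _; rewrite mup_deriv_ram.
rewrite -(sum_mup dg (fiber_uniq g c)) => [|z z_root]; last first.
  have ram_z : (1 < ram g z)%N.
    by rewrite -mup_gt0 // mup_deriv_ram // in z_root; move: z_root; case: (ram g z) => [|[]].
  rewrite mem_fiber //; apply/eqP; apply: contraTeq isT => c_neq.
  have cz_crit : critical g.[z].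
    by apply/orP; left; apply/hasP; exists z; rewrite ?mem_fiber.
  have [le1 _] := size_fiber_le (critical_type c_crit).
  have [le2 _] := size_fiber_le (critical_type cz_crit).
  have cs_uniq : uniq [:: g.[z]; c] by rewrite /= inE c_neq.
  have := sum_mup_le dg (uniq_fibers g1 cs_uniq).
  rewrite /= cats0 big_cat /= !sumE.
  have := sum_ram_pred c g1 (tc_szg C); have := sum_ram_pred g.[z] g1 (tc_szg C).
  have := size_deriv_le (tc_g C) (tc_szg C) dg; move: le1 le2 (prime_gt1 p_pr).
  move: (size (fiber g c)) (size (fiber g _)) (size g^`()).
  by move: (\sum_(y <- _) _)%N (\sum_(y <- _) _)%N; clear; lia.
by rewrite sumE sum_ram_pred // (tc_szg C).
Qed.

(** The indices of [h] above [(a, b)] add up to [ram gs b = 1]. In the simple pattern the point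
    found here is the shift [w]. *)
Lemma simple_point a b : g.[a] = gs.[b] -> ram g a = 1%N -> ram gs b = 1%N ->
  exists z, [/\ h.[z] = a, hs.[z] = b, ram h z = 1%N, ram hs z = 1%N
    & forall y, h.[y] = a -> hs.[y] = b -> y = z].
Proof.
move=> gab ra rb; have [g1 h1 gs1 hs1] := tc_gt1 charKp C.
have := over_excess charKp C gab; have := mem_over charKp C a b.
rewrite rb; set s := over h hs a b => memE sumE.
have sz_s : size s = 1%N.
  case szs: (size s) sumE => [|[|n]] // sumE; last first.
    by move: sumE; rewrite !addnS.
  by move/size0nil: szs sumE => ->; rewrite big_nil.
have [z sE] : exists z, s = [:: z] by case: s sz_s {memE sumE} => [|z []] //; exists z.
have : z \in s by rewrite sE mem_head.
rewrite memE => /andP[/eqP hz /eqP hsz].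
have rz : ram h z = 1%N.
  by move: sumE (ram_gt0 z h1); rewrite sE big_seq1 addn1; case: (ram h z) => [|[]].
exists z; split=> //.
  by have := ram_balance charKp C z; rewrite hz hsz ra rb rz !mul1n.
by move=> y hy hsy; apply/eqP; rewrite -mem_seq1 -sE memE hy hsy !eqxx.
Qed.

Lemma exists_fiber (q : {poly K}) c : (1 < size q)%N -> exists z, q.[z] = c.
Proof.
move=> q1; have /closed_rootP[z] : size (q - c%:P) != 1%N by rewrite size_subC // gtn_eqF.
by rewrite root_subC => /eqP qz; exists z.
Qed.

Lemma noncritical_ram c : ~~ critical c ->
  (forall a, g.[a] = c -> ram g a = 1%N) /\ (forall b, gs.[b] = c -> ram gs b = 1%N).
Proof.
have [g1 h1 gs1 hs1] := tc_gt1 charKp C.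
rewrite negb_or => /andP[/hasPn gA /hasPn gB].
split=> a ga; apply/eqP; rewrite eqn_leq ram_gt0 // andbT leqNgt.
  by apply: gA; rewrite mem_fiber // ga.
by apply: gB; rewrite mem_fiber // ga.
Qed.

Lemma exists_simple_root c : ~ multiple_value c ->
  exists z, (g \Po h).[z] = c /\ ram (g \Po h) z = 1%N.
Proof.
move=> not_mult; have [g1 h1 gs1 hs1] := tc_gt1 charKp C.
suff [a [b [ga gb ra rb]]] :
    exists a b, [/\ g.[a] = c, gs.[b] = c, ram g a = 1%N & ram gs b = 1%N].
  have [|z [hz _ rz _ _]] := simple_point _ ra rb; first by rewrite ga gb.
  by exists z; rewrite ram_comp // horner_comp hz ra rz.
have [c_crit|nc] := boolP (critical c).
  case: (critical_type c_crit) => [[M [a0 [b0 [_ [a0A b0B ra rb] _ _ _]]]]|//].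
  by exists a0, b0; rewrite mem_fiber // in a0A; rewrite mem_fiber // in b0B;
    split=> //; apply/eqP.
have [a ga] := exists_fiber c g1; have [b gb] := exists_fiber c gs1.
by have [ra rb] := noncritical_ram nc; exists a, b; split=> //; [apply: ra|apply: rb].
Qed.

(** For the pattern [m, p - m] all multiplicities of [g - c] exceed [1], and composition with [h]
    only multiplies them. Any other value has points of multiplicity [1] for both [g] and [gs],
    which [simple_point] lifts to a simple root. This turns the definition of multiply original into
    a statement about [multiple_value]. *)
Lemma no_simple_rootP c :
  (forall z, mup z ((g \Po h) - c%:P) <> 1%N) <-> multiple_value c.
Proof.
have [g1 h1 gs1 hs1] := tc_gt1 charKp C.
split=> [no_simple|].
  apply: contrapT => /exists_simple_root[z [fz rz]].
  by apply: (no_simple z); rewrite -fz -/(ram _ z).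
case=> m [a1 [a2 [b1 [b2 [m_lt _ [r1 r2 _ _] memA _]]]]] z mup1.
have f1 : (1 < size (g \Po h))%N.
  have := size_comp_poly g h; rewrite (tc_szg C) (tc_szh C) /=.
  have := prime_gt0 p_pr; case: (size _) => [|[|]] //= p_gt0 /esym/eqP; nia.
move: mup1; rewrite mup_subC //; case: eqP => // fz.
rewrite ram_comp // => /eqP; rewrite muln_eq1 => /andP[/eqP r _].
have : h.[z] \in fiber g c by rewrite mem_fiber // -horner_comp fz.
rewrite memA => /orP[] /eqP hz; move: r; rewrite hz ?r1 ?r2; move: m_lt; clear; lia.
Qed.

(** Divisibility by [M] is what [ram_balance] transports from the outer to the inner polynomials;
    together with the degree of [q'] it determines the form of [q] in [simple_form]. *)
Definition simple_over M l (q : {poly K}) z :=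
  [/\ ram q z = 1%N, size q^`() = (l * M.-1).+1
    & forall y, y != z -> q.[y] = q.[z] -> (M %| ram q y)%N].

(** The clause [M = 1 -> w = 0] supplies a rational shift in the unramified case, where every point
    would do and the coefficients single out none. *)
Lemma simple_structure : (forall c, ~ multiple_value c) ->
  exists M l w, [/\ (0 < M)%N, M = 1%N -> w = 0 & (M * l).+1 = p] /\
    [/\ simple_over M l h w, simple_over M l hs w,
        simple_over M l g h.[w] & simple_over M l gs hs.[w]].
Proof.
move=> not_mult; have [g1 h1 gs1 hs1] := tc_gt1 charKp C.
have [dg dh dgs dhs] := tc_deriv_neq0 C.
have [eqg eqh eqd] := size_deriv_collision charKp (tc_g C) (tc_h C) (tc_gs C)
  (tc_hs C) (tc_szg C) (tc_szh C) (tc_szgs C) (tc_szhs C) (tc_h0 C) (tc_hs0 C)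
  (tc_neq C) (tc_comp C) (tc_deriv C).
have [[c c_crit]|no_crit] := pselect (exists c, critical c).
  case: (critical_type c_crit) => [|/not_mult//].
  case=> M [a0 [b0 [M_gt1 [a0A b0B ra rb] eA eB [szA szB]]]].
  rewrite mem_fiber // in a0A; rewrite mem_fiber // in b0B.
  have [|w [hw hsw rw rsw w_uniq]] := simple_point _ ra rb.
    by rewrite (eqP a0A) (eqP b0B).
  exists M, (size (fiber g c)).-1, w; split.
    by split; rewrite ?(ltnW M_gt1) // => M1; rewrite M1 in M_gt1.
  have szg' : size g^`() = ((size (fiber g c)).-1 * M.-1).+1.
    have := size_deriv_critical c_crit; move: szA M_gt1.
    have : (0 < size (fiber g c))%N.
      by rewrite -has_predT; apply/hasP; exists a0; rewrite ?mem_fiber.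
    have := dg; rewrite -size_poly_gt0.
    move: (size (fiber g c)) (size g^`()); clear => n m; case: n => [|n] //=.
    case: m => // m; case: M => [|[|M]] //= ; nia.
  (* If [h.[y] = a0] and [y != w], uniqueness of [w] forces [hs.[y] != b0]; there [gs] has
     multiplicity [M], and since [ram g a0 = 1] the chain rule passes it on to [h]. *)
  have over_dvd y : y != w -> (h.[y] = a0 -> M %| ram h y)%N /\ (hs.[y] = b0 -> M %| ram hs y)%N.
    move=> y_neq; have := ram_balance charKp C y; split=> hy.
      rewrite hy ra mul1n in H; rewrite H eB ?dvdn_mulr //.
        by rewrite mem_fiber // -horner_comp -(tc_comp C) horner_comp hy.
      by apply: contraNneq y_neq => hsy; apply/eqP/w_uniq.
    rewrite hy rb mul1n in H; rewrite -H eA ?dvdn_mulr //.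
      by rewrite mem_fiber // -horner_comp (tc_comp C) horner_comp hy.
    by apply: contraNneq y_neq => hsy; apply/eqP/w_uniq.
  split; split; rewrite ?hw ?hsw //.
  - by rewrite eqh -eqd.
  - by move=> y /over_dvd[].
  - by rewrite -eqd.
  - by move=> y /over_dvd[].
  - by move=> y y_neq gy; rewrite eA ?dvdnn // mem_fiber // gy.
  - by rewrite -eqg.
  - by move=> y y_neq gy; rewrite eB ?dvdnn // mem_fiber // gy.
have ram_g z : ram g z = 1%N.
  have nc : ~~ critical g.[z] by apply/negP => z_crit; apply: no_crit; exists g.[z].
  by have [-> //] := noncritical_ram nc.
have [gb hb gsb hsb] := ram_bound.
have szg' : size g^`() = 1%N.
  apply: contrapT => /eqP/closed_rootP[z]; rewrite -mup_gt0 // mup_deriv_ram //.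
  by rewrite ram_g.
have ram1 (q : {poly K}) z : (1 < size q)%N -> (0 < ram q z < p)%N ->
    size q^`() = 1%N -> ram q z = 1%N.
  move=> q1 rb szq'.
  have := mup_deriv_ram q1 rb; rewrite mupNroot.
    by case: (ram q z) rb => [|[]].
  by apply/negP => q'z; have /closed_rootP : exists x, root q^`() x by [exists z]; rewrite szq'.
have szh' : size h^`() = 1%N by rewrite eqh -eqd.
have szgs' : size gs^`() = 1%N by rewrite -eqg.
have szhs' : size hs^`() = 1%N by rewrite -eqd.
exists 1%N, p.-1, 0; rewrite mul1n (prednK (prime_gt0 p_pr)); split; first by [].
by split; split=> [||y _ _]; first [exact: ram1 | exact: dvd1n | rewrite muln0].
Qed.
End CriticalValues.

(** * Normal forms over the closure *)
Section Shift.
Variable F : fieldType.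
Implicit Types (f g h q : {poly F}) (w : F).

Lemma original_shiftE w f : original_shift w f = f \Po ('X + w%:P) - f.[w]%:P.
Proof. by rewrite /original_shift comp_polyB comp_polyX comp_polyC. Qed.

Lemma size_XaddC w : size ('X + w%:P) = 2%N.
Proof. by rewrite -[w]opprK polyCN size_XsubC. Qed.

Lemma size_original_shift w f : (1 < size f)%N -> size (original_shift w f) = size f.
Proof.
move=> f1; rewrite original_shiftE size_polyDl size_comp_poly2 ?size_XaddC //.
by rewrite size_polyN size_polyC (leq_ltn_trans (leq_b1 _)).
Qed.

Lemma deriv_original_shift w f : (original_shift w f)^`() = f^`() \Po ('X + w%:P).
Proof.
by rewrite original_shiftE derivB derivC subr0 deriv_comp derivD derivX derivC addr0 mulr1.
Qed.

Lemma original_shift_comp w g h :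
  original_shift h.[w] g \Po original_shift w h = original_shift w (g \Po h).
Proof.
rewrite 2!original_shiftE original_shiftE horner_comp comp_polyB comp_polyC.
congr (_ - _); rewrite -!comp_polyA; congr (_ \Po _).
by rewrite comp_polyD comp_polyX comp_polyC subrK.
Qed.

(** Since [M l = -1] in [F], the cofactor [(x^l - A) + M l x^l] of [(x^l - A)^(M - 1)] in the
    derivative reduces to [-A]. *)
Lemma deriv_simple_form p M l (A : F) : p \in [pchar F] -> (0 < M)%N -> (M * l).+1 = p ->
  ('X * ('X^l - A%:P) ^+ M)^`() = - A *: ('X^l - A%:P) ^+ M.-1.
Proof.
move=> charFp; case: M => // M _ Mlp.
have l_gt0 : (0 < l)%N.
  by case: l Mlp => //; rewrite muln0 => p1; have := pcharf_prime charFp; rewrite -p1.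
have Ml : (M.+1%:R * l%:R + 1 : F) = 0.
  by rewrite -natrM natr1 Mlp (pcharf0 charFp).
rewrite derivM derivX mul1r deriv_exp derivB derivXn derivC subr0 /= exprS.
rewrite -mul_polyC polyCN -mulr_natr -[_ *+ l]mulr_natr.
set Z := 'X^l; set Y := Z - A%:P.
have XlE : 'X * 'X^(l.-1) = Z by rewrite -exprS prednK.
have Ml' : (M.+1%:R * l%:R + 1 : {poly F}) = 0.
  by rewrite -[RHS]/(0%:P) -Ml polyCD polyCM !polyC_natr.
transitivity (Y ^+ M * (Y + (M.+1%:R * l%:R) * ('X * 'X^(l.-1)))); first by ring.
have -> : M.+1%:R * l%:R = -1 :> {poly F} by apply/eqP; rewrite -subr_eq0 opprK Ml'.
by rewrite XlE /Y mulN1r addrAC subrr add0r mulrC.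
Qed.
End Shift.

Section SimpleForm.
Variables (K : closedFieldType) (p : nat).
Hypothesis charKp : p \in [pchar K].

Lemma simple_form M l (q : {poly K}) w : (0 < M)%N -> (M * l).+1 = p ->
  q \is monic -> size q = p.+1 -> simple_over M l q w ->
  exists2 A, A != 0 & original_shift w q = 'X * ('X^l - A%:P) ^+ M.
Proof.
move=> M_gt0 Mlp q_m szq [rw szq' dvd_ram].
have p_pr := pcharf_prime charKp; have p_gt0 := prime_gt0 p_pr.
have q1 : (1 < size q)%N by rewrite szq ltnS.
have qc_m : q - q.[w]%:P \is monic.
  rewrite monicE lead_coefDl -?monicE // size_polyN size_polyC.
  exact: leq_ltn_trans (leq_b1 _) q1.
pose R : {poly K} := \prod_(z <- fiber q q.[w] | z != w) ('X - z%:P) ^+ (ram q z %/ M).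
have qE : q - q.[w]%:P = ('X - w%:P) * R ^+ M.
  have w_fib : w \in fiber q q.[w] by rewrite mem_fiber.
  rewrite {1}(zeros_monic qc_m) -(prodr_undup_exp_count (zeros _) xpredT).
  rewrite -/(fiber q q.[w]) (bigD1_seq w) ?fiber_uniq //=.
  rewrite -mup_zeros ?monic_neq0 // -/(ram q w) rw expr1 -prodrXl; congr (_ * _).
  rewrite [LHS]big_seq_cond [RHS]big_seq_cond.
  apply: eq_bigr => z /andP[]; rewrite mem_fiber // => /eqP qz z_neq.
  by rewrite -exprM divnK ?dvd_ram // /ram qz mup_zeros ?monic_neq0.
pose R1 := R \Po ('X + w%:P).
have R_m : R \is monic by apply: monic_prod => z _; rewrite rpredX // monicXsubC.
have R1_m : R1 \is monic.
  rewrite monicE lead_coef_comp ?size_XaddC // (monicP R_m) mul1r -[w]opprK polyCN.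
  by rewrite lead_coefXsubC expr1n.
have QE : original_shift w q = 'X * R1 ^+ M.
  rewrite original_shiftE -(comp_polyC q.[w] ('X + w%:P)) -comp_polyB qE.
  by rewrite comp_polyM comp_polyB comp_polyX comp_polyC addrK rmorphXn.
have R1k_neq0 k : R1 ^+ k != 0 by rewrite monic_neq0 ?rpredX.
have szR1M k : size (R1 ^+ k) = (((size R1).-1 * k).+1)%N.
  by rewrite -size_exp prednK // size_poly_gt0 monic_neq0 // rpredX.
have szR1 : size R1 = l.+1.
  have R1_gt0 : (0 < size R1)%N by rewrite size_poly_gt0 monic_neq0.
  have := size_original_shift w q1; rewrite QE mulrC size_mulX ?monic_neq0 ?rpredX //.
  rewrite szR1M szq -Mlp => -[/eqP]; rewrite mulnC eqn_pmul2l // => /eqP <-.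
  by rewrite prednK.
have szR1M' k : size (R1 ^+ k) = (l * k).+1 by rewrite szR1M szR1.
(* The derivative of [x R1^M] is [R1^(M-1) L], and the bound on its degree
   makes [L] constant, which kills all inner coefficients of [R1]. *)
pose L := R1 + 'X * R1^`() *+ M.
have dQE : (original_shift w q)^`() = R1 ^+ M.-1 * L.
  rewrite QE derivM derivX mul1r deriv_exp /L mulrDr -exprSr prednK //.
  by congr (_ + _); rewrite mulrnAr mulrnAr; congr (_ *+ _); ring.
have szL : size L = 1%N.
  have : size (R1 ^+ M.-1 * L) = (l * M.-1).+1.
    by rewrite -dQE deriv_original_shift size_comp_poly2 ?size_XaddC.
  have L0 : L != 0.
    by apply: contra_eq_neq dQE => ->; rewrite mulr0 -size_poly_eq0
      deriv_original_shift size_comp_poly2 ?size_XaddC // szq'.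
  rewrite (size_mul (R1k_neq0 _) L0) szR1M' addSn /= => /eqP.
  by rewrite -addn1 eqn_add2l => /eqP.
(* For [0 < k < l] the factor [M k + 1] lies strictly between [0] and [p], so it is invertible and
   [R1] has no coefficient of degree [k]. *)
have Lcoef k : L`_k = R1`_k * (M * k).+1%:R.
  rewrite /L coefD coefMn coefXM coef_deriv; case: k => [|k] /=.
    by rewrite muln0 mul0rn addr0 mulr1.
  by rewrite -mulrnA mulr_natr mulrS mulnC.
exists (- R1`_0).
  rewrite oppr_eq0; apply/eqP => R10; have := Lcoef 0%N.
  rewrite R10 mul0r => L00; have /size1_polyC L_C : (size L <= 1)%N by rewrite szL.
  by have := szL; rewrite L_C L00 size_poly0.
rewrite QE; congr ('X * _ ^+ M).
apply/polyP => k; rewrite coefB coefXn coefC.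
case: (ltngtP k l) => [lt_kl|gt_kl|->].
- case: k lt_kl => [|k] lt_kl; rewrite ?eqxx ?sub0r ?opprK ?subr0 //=.
  have := Lcoef k.+1; rewrite nth_default ?szL // => /esym/eqP.
  rewrite mulf_eq0 (negPf (natf_neq0_lt charKp _)) ?orbF => [/eqP->|].
    by rewrite oppr0.
  by rewrite /= -[in ltnRHS]Mlp ltnS ltn_pmul2l.
- by rewrite nth_default ?szR1 // (gtn_eqF (leq_ltn_trans (leq0n _) gt_kl)) subr0.
- have l_gt0 : (0 < l)%N.
    case: l Mlp {szq' qE szR1 szR1M' dvd_ram} => //.
    by rewrite muln0 => p1; move: p_pr; rewrite -p1.
  have /monicP := R1_m; rewrite lead_coefE szR1 /= => ->.
  by rewrite (gtn_eqF l_gt0) subr0.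
Qed.
End SimpleForm.

Definition part (K : closedFieldType) (h hs : {poly K}) a b : {poly K} :=
  \prod_(z <- over h hs a b) ('X - z%:P) ^+ ram h z.

Section MultipleForm.
Variables (K : closedFieldType) (p : nat) (g h gs hs : {poly K}).
Hypotheses (charKp : p \in [pchar K]) (C : tame_collision p g h gs hs).

Let p_pr : prime p := pcharf_prime charKp.

Lemma partC a b :
  part hs h b a = \prod_(z <- over h hs a b) ('X - z%:P) ^+ ram hs z.
Proof.
have Cs := tame_collision_sym C.
apply: perm_big; apply: uniq_perm => [||z]; rewrite ?over_uniq //.
by rewrite (mem_over charKp C) (mem_over charKp Cs) andbC.
Qed.

Lemma fiber_split c a b1 b2 : b1 != b2 ->
  (forall b, (b \in fiber gs c) = (b == b1) || (b == b2)) ->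
  g.[a] = c -> h - a%:P = part h hs a b1 * part h hs a b2.
Proof.
move=> b_neq memB ga; have [g1 h1 gs1 hs1] := tc_gt1 charKp C.
have h_m : h - a%:P \is monic.
  rewrite monicE lead_coefDl -?monicE ?(tc_h C) // size_polyN size_polyC.
  exact: leq_ltn_trans (leq_b1 _) h1.
rewrite {1}(zeros_monic h_m) -(prodr_undup_exp_count (zeros _) xpredT) -/(fiber h a).
rewrite (bigID (fun z => hs.[z] == b1)) /= -big_filter -[X in _ * X]big_filter.
have exp_ram (s : seq K) : {subset s <= fiber h a} ->
    \prod_(z <- s) ('X - z%:P) ^+ count_mem z (zeros (h - a%:P)) =
    \prod_(z <- s) ('X - z%:P) ^+ ram h z.
  move=> s_sub; apply: eq_big_seq => z /s_sub; rewrite mem_fiber // => /eqP hz.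
  by rewrite /ram hz mup_zeros ?subC_neq0.
rewrite !exp_ram; try by move=> z; rewrite mem_filter => /andP[].
congr (_ * _); apply: perm_big; apply: uniq_perm;
  rewrite ?filter_uniq ?fiber_uniq // => z; rewrite (mem_over charKp C) mem_filter mem_fiber //.
  by rewrite andbC.
rewrite andbC; case: eqP => //= hz.
have : hs.[z] \in fiber gs c by rewrite mem_fiber // -horner_comp -(tc_comp C) horner_comp hz ga.
by rewrite memB => /orP[] /eqP ->; rewrite eqxx ?b_neq ?(negPf b_neq) // eq_sym b_neq.
Qed.

(** As in [excess_coprime] there is a single point [w]; by [ram_balance] the indices are crossed,
    [h] taking that of [gs] and [hs] that of [g]. *)
Lemma coprime_part a b : g.[a] = gs.[b] -> coprime (ram g a) (ram gs b) ->
  exists w, [/\ h.[w] = a, hs.[w] = b, part h hs a b = ('X - w%:P) ^+ ram gs b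
    & part hs h b a = ('X - w%:P) ^+ ram g a].
Proof.
move=> gab cop; have [g1 h1 gs1 hs1] := tc_gt1 charKp C.
have := over_excess charKp C gab; have := excess_coprime charKp C gab cop.
have := mem_over charKp C a b; rewrite partC /part.
set s := over h hs a b => memE X_ge sumE.
have sz_s : (size s <= 1)%N.
  move: X_ge sumE (ram_gt0 b gs1).
  by move: (ram gs b) (\sum_(z <- _) _)%N (size s); clear; lia.
case sE: s sz_s => [|w []] // _.
  by move: sumE (ram_gt0 b gs1); rewrite sE big_nil => <-.
have : w \in s by rewrite sE mem_head.
rewrite memE => /andP[/eqP hw /eqP hsw].
have rw : ram h w = ram gs b.
  by move: sumE (ram_gt0 w h1); rewrite sE big_seq1 addn1 => + /prednK => -> ->.
exists w; split=> //; rewrite big_seq1 ?rw //.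
have := ram_balance charKp C w; rewrite hw hsw rw mulnC => /eqP.
by rewrite eqn_pmul2l ?ram_gt0 // => /eqP ->.
Qed.

(** Equal outer indices cancel in [ram_balance], so [h] and [hs] have the same index at each point
    above [(a, b)]. *)
Lemma equal_part a b : g.[a] = gs.[b] -> ram g a = ram gs b ->
  part h hs a b = part hs h b a.
Proof.
move=> gab rab; have [g1 h1 gs1 hs1] := tc_gt1 charKp C.
rewrite partC; apply: eq_big_seq => z; rewrite (mem_over charKp C) => /andP[/eqP hz /eqP hsz].
have := ram_balance charKp C z; rewrite hz hsz rab => /eqP.
by rewrite eqn_pmul2l ?ram_gt0 // => /eqP ->.
Qed.

End MultipleForm.

Lemma fiber_two (K : closedFieldType) (q : {poly K}) c a1 a2 :
  (1 < size q)%N -> q \is monic -> a1 != a2 ->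
  (forall a, (a \in fiber q c) = (a == a1) || (a == a2)) ->
  q - c%:P = ('X - a1%:P) ^+ ram q a1 * ('X - a2%:P) ^+ ram q a2.
Proof.
move=> q1 q_m a_neq memA.
have qc_m : q - c%:P \is monic.
  rewrite monicE lead_coefDl -?monicE // size_polyN size_polyC.
  exact: leq_ltn_trans (leq_b1 _) q1.
rewrite {1}(zeros_monic qc_m) -(prodr_undup_exp_count (zeros _) xpredT) -/(fiber q c).
rewrite (perm_big [:: a1; a2]) /=; last first.
  by apply: uniq_perm; rewrite ?fiber_uniq //= ?inE ?a_neq // => z; rewrite memA !inE.
have ramE a : a \in fiber q c -> count_mem a (zeros (q - c%:P)) = ram q a.
  by rewrite mem_fiber // => /eqP qa; rewrite /ram qa mup_zeros ?subC_neq0.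
by rewrite big_cons big_seq1 !ramE // memA eqxx ?orbT.
Qed.

(** With [w] above [(a1, b1)] and [v] above [(a2, b2)], the coprime pairs contribute powers of
    [x - w] and [x - v], and the equal pairs contribute polynomials [A] and [B] common to [h] and
    [hs]. The parameters are [b = v - w] and [a = a2 - a1]. *)
Lemma multiple_form (K : closedFieldType) p (g h gs hs : {poly K}) c :
  p \in [pchar K] -> tame_collision p g h gs hs -> multiple_value p g gs c ->
  exists m w a b,
  [/\ [/\ b != 0, a != 0, a != b ^+ p & (1 < m < p.-1)%N],
     original_shift h.[w] g = multiple_left p a m,
     original_shift w h = multiple_right p a b m,
     original_shift hs.[w] gs = multiple_left_star p a b m
   & original_shift w hs = multiple_right_star p a b m].
Proof.
move=> charKp C; have p_pr := pcharf_prime charKp.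
have [g1 h1 gs1 hs1] := tc_gt1 charKp C; have Cs := tame_collision_sym C.
case=> m [a1 [a2 [b1 [b2 [m_lt [a_neq b_neq] [ra1 ra2 rb1 rb2] memA memB]]]]].
have [ga1 ga2] : g.[a1] = c /\ g.[a2] = c.
  by split; apply/eqP; rewrite -mem_fiber // memA eqxx ?orbT.
have [gb1 gb2] : gs.[b1] = c /\ gs.[b2] = c.
  by split; apply/eqP; rewrite -mem_fiber // memB eqxx ?orbT.
have m_gt0 : (0 < m)%N by move: m_lt; clear; lia.
have lt_mp : (m < p)%N by move: m_lt; clear; lia.
have cop : coprime m (p - m).
  rewrite /coprime -gcdnDr subnK ?(ltnW lt_mp) // gcdnC.
  by rewrite -/(coprime _ _) prime_coprime // gtnNdvd.
set ms := (p - m)%N in cop ra2 rb1 *.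
have gab1 : g.[a1] = gs.[b1] by rewrite ga1.
have gab2 : g.[a2] = gs.[b2] by rewrite ga2.
have cop1 : coprime (ram g a1) (ram gs b1) by rewrite ra1 rb1.
have cop2 : coprime (ram g a2) (ram gs b2) by rewrite ra2 rb2 coprime_sym.
have [w [hw hsw p11 ps11]] := coprime_part charKp C gab1 cop1.
have [v [hv hsv p22 ps22]] := coprime_part charKp C gab2 cop2.
rewrite ra1 rb1 in p11 ps11; rewrite ra2 rb2 in p22 ps22.
set A := part h hs a1 b2; set B := part h hs a2 b1.
have AE : part hs h b2 a1 = A by rewrite -(equal_part charKp C) ?ga1 ?ra1.
have BE : part hs h b1 a2 = B by rewrite -(equal_part charKp C) ?ga2 ?ra2.
have E1 := fiber_split charKp C b_neq memB ga1; have E2 := fiber_split charKp C b_neq memB ga2.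
have F1 := fiber_split charKp Cs a_neq memA gb1.
have F2 := fiber_split charKp Cs a_neq memA gb2.
rewrite -/A -/B p11 p22 in E1 E2; rewrite AE BE ps11 ps22 in F1 F2.
pose a := a2 - a1; pose as_ := b2 - b1; pose b := v - w.
exists m, w, a, b.
have charP : [pchar {poly K}].-nat p.
  by rewrite pnatE // pchar_poly.
pose X1 : {poly K} := 'X - w%:P; pose X2 : {poly K} := 'X - v%:P.
have X12 : X1 ^+ p - X2 ^+ p = (b ^+ p)%:P.
  rewrite -exprNn_pchar // -exprDn_pchar // rmorphXn /=; congr (_ ^+ p).
  by rewrite /X1 /X2 /b polyCB; ring.
have E12 : X1 ^+ ms * A - X2 ^+ m * B = a%:P.
  by rewrite [X2 ^+ m * B]mulrC -E1 -E2 /a polyCB; ring.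
have F12 : X1 ^+ m * B - X2 ^+ ms * A = as_%:P.
  by rewrite [X2 ^+ ms * A]mulrC -F1 -F2 /as_ polyCB; ring.
have X1p : X1 ^+ p = X1 ^+ m * X1 ^+ ms by rewrite -exprD subnKC // ltnW.
have X2p : X2 ^+ p = X2 ^+ m * X2 ^+ ms by rewrite -exprD subnKC // ltnW.
(* [E12] and [F12] are linear in [A] and [B], with determinant
   [X1^p - X2^p = b^p]. *)
have AbE : (b ^+ p)%:P * A = a%:P * X1 ^+ m + as_%:P * X2 ^+ m.
  by rewrite -X12 -E12 -F12 X1p X2p; ring.
have BbE : (b ^+ p)%:P * B = a%:P * X2 ^+ ms + as_%:P * X1 ^+ ms.
  by rewrite -X12 -E12 -F12 X1p X2p; ring.
have b_neq0 : b != 0.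
  rewrite subr_eq0; apply: contraNneq a_neq => vw.
  by rewrite -hw -hv vw.
have bp_neq0 : b ^+ p != 0 by rewrite expf_neq0.
(* Comparison of the coefficients of degree [m] in [AbE], where [A] is monic of degree [m]. *)
have abE : b ^+ p - a = as_.
  have A_m : A \is monic by apply: monic_prod => z _; rewrite rpredX // monicXsubC.
  have X_m z n : ('X - z%:P : {poly K}) ^+ n \is monic by rewrite rpredX // monicXsubC.
  have szA : size A = m.+1.
    have := congr1 (fun P : {poly K} => size P) E1.
    rewrite /= size_subC // (tc_szh C) size_monicM ?monic_neq0 // size_exp_XsubC /=.
    by move=> szE; apply/eqP; rewrite -(eqn_add2l ms) -szE addnS subnK // ltnW.
  have := congr1 (fun P : {poly K} => P`_m) AbE.
  have X1m z : (('X - z%:P : {poly K}) ^+ m)`_m = 1.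
    by have /monicP := X_m z m; rewrite lead_coefE size_exp_XsubC.
  rewrite coefCM coefD !coefCM /X1 /X2 !X1m.
  have /monicP := A_m; rewrite lead_coefE szA /= => ->.
  by rewrite !mulr1 => ->; rewrite addrC addKr.
have bpE : (b ^+ p)%:P = a%:P + as_%:P :> {poly K} by rewrite -polyCD -abE subrKC.
have shiftE (q : {poly K}) z : original_shift z q = (q - q.[z]%:P) \Po ('X + z%:P).
  by rewrite comp_polyB comp_polyC original_shiftE.
have compX (z y : K) n : ('X - y%:P) ^+ n \Po ('X + z%:P) = ('X - (y - z)%:P) ^+ n.
  by rewrite rmorphXn /= comp_polyB comp_polyX comp_polyC polyCB opprB addrA.
have scaleI (P Q : {poly K}) : (b ^+ p)%:P * P = (b ^+ p)%:P * Q -> P = Q.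
  by apply: mulfI; rewrite polyC_eq0.
have Xp : ('X : {poly K}) ^+ p = 'X^m * 'X^ms by rewrite -exprD subnKC // ltnW.
have bpD x (P Q : {poly K}) :
    (b ^+ p)%:P * (P + (x * b ^- p) *: Q) = (b ^+ p)%:P * P + x%:P * Q.
  by rewrite mulrDr -mul_polyC mulrA -polyCM mulrCA divff // mulr1.
split.
- split=> //; first by rewrite subr_eq0 eq_sym.
  by rewrite eq_sym -subr_eq0 abE subr_eq0 eq_sym.
- rewrite shiftE hw ga1 (fiber_two g1 (tc_g C) a_neq memA) ra1 ra2 comp_polyM !compX.
  by rewrite subrr subr0.
- rewrite shiftE hw E1 comp_polyM compX subrr subr0.
  apply: scaleI; rewrite mulrCA -(comp_polyC (b ^+ p) ('X + w%:P)) -comp_polyM AbE.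
  rewrite comp_polyD !comp_polyM !comp_polyC !compX subrr subr0 -/b.
  by rewrite /multiple_right -/ms abE bpD Xp bpE; ring.
- rewrite shiftE hsw gb1 (fiber_two gs1 (tc_gs C) b_neq memB) rb1 rb2 comp_polyM !compX.
  by rewrite subrr subr0 /multiple_left_star abE.
- rewrite shiftE hsw F1 comp_polyM compX subrr subr0.
  apply: scaleI; rewrite mulrCA -(comp_polyC (b ^+ p) ('X + w%:P)) -comp_polyM BbE.
  rewrite comp_polyD !comp_polyM !comp_polyC !compX subrr subr0 -/b.
  by rewrite /multiple_right_star -/ms bpD Xp bpE; ring.
Qed.

(** * Descent to the base field *)
Section SubtopCoefficients.
Variable R : fieldType.
Implicit Types P Q : {poly R}.

(** The second coefficient is minus the sum of the zeros, hence additive on products of monic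
    polynomials. It serves to recover the shift [w]. *)
Lemma coefM_subtop P Q n k : P \is monic -> Q \is monic ->
  size P = n.+2 -> size Q = k.+2 -> (P * Q)`_(n + k).+1 = P`_n + Q`_k.
Proof.
move=> P_m Q_m szP szQ.
have szP1 := size_subXn P_m szP; have szQ1 := size_subXn Q_m szQ.
set P1 := P - 'X^(n.+1) in szP1; set Q1 := Q - 'X^(k.+1) in szQ1.
have -> : P * Q = 'X^(n.+1) * Q + P1 * 'X^(k.+1) + P1 * Q1.
  by rewrite /P1 /Q1; ring.
rewrite !coefD coefXnM coefMXn [(P1 * Q1)`__]nth_default; last first.
  rewrite (leq_trans (size_polyMleq _ _)) // -subn1 leq_subLR.
  by rewrite (leq_trans (leq_add szP1 szQ1)) // addSn addnS.
rewrite !ltnS !ltnNge leq_addr leq_addl /= !subSS addKn addnK addr0 addrC.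
by rewrite /P1 coefB coefXn ltn_eqF ?subr0.
Qed.

Lemma coef_exp_subtop P n k : P \is monic -> size P = n.+2 ->
  (P ^+ k.+1)`_(n + n.+1 * k) = P`_n *+ k.+1.
Proof.
move=> P_m szP; elim: k => [|k IHk]; first by rewrite muln0 addn0 expr1.
have Pk_m : P ^+ k.+1 \is monic by rewrite rpredX.
have szPk : size (P ^+ k.+1) = (n + n.+1 * k).+2.
  have := size_exp P k.+1; rewrite szP /=; have := monic_neq0 Pk_m.
  by rewrite -size_poly_gt0; case: (size _) => //= m _ ->; rewrite mulnS.
rewrite exprS (_ : (n + n.+1 * k.+1 = (n + (n + n.+1 * k)).+1)%N).
  by rewrite coefM_subtop // IHk -mulrS.
by rewrite mulnS addSn addnS.
Qed.

Lemma coef_XsubC_exp (c : R) k : (('X - c%:P) ^+ k.+1)`_k = - c *+ k.+1.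
Proof.
have := coef_exp_subtop k (monicXsubC c) (size_XsubC c).
by rewrite add0n mul1n => ->; rewrite coefB coefX coefC sub0r.
Qed.
End SubtopCoefficients.

Section Descent.
Variables (F K : fieldType) (iota : {rmorphism F -> K}).
Local Notation "q ^i" := (map_poly iota q) (at level 2).

Definition in_base x := exists y, x = iota y.

Lemma in_base_iota y : in_base (iota y). Proof. by exists y. Qed.
Lemma in_baseD x y : in_base x -> in_base y -> in_base (x + y).
Proof. by case=> x0 -> [y0 ->]; exists (x0 + y0); rewrite rmorphD. Qed.
Lemma in_baseN x : in_base x -> in_base (- x).
Proof. by case=> x0 ->; exists (- x0); rewrite rmorphN. Qed.
Lemma in_baseM x y : in_base x -> in_base y -> in_base (x * y).
Proof. by case=> x0 -> [y0 ->]; exists (x0 * y0); rewrite rmorphM. Qed.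
Lemma in_baseV x : in_base x -> in_base x^-1.
Proof. by case=> x0 ->; exists x0^-1; rewrite fmorphV. Qed.
Lemma in_base_nat n : in_base n%:R.
Proof. by exists n%:R; rewrite rmorph_nat. Qed.
Lemma in_base_coef (q : {poly F}) k : in_base (q^i)`_k.
Proof. by rewrite coef_map; apply: in_base_iota. Qed.

Lemma in_base_mulI x y : in_base (x * y) -> x != 0 -> in_base x -> in_base y.
Proof. by move=> xy x0 /in_baseV xV; have := in_baseM xV xy; rewrite mulKf. Qed.

Lemma in_base_addI x y : in_base (x + y) -> in_base x -> in_base y.
Proof. by move=> xy /in_baseN xN; have := in_baseD xN xy; rewrite addKr. Qed.

Lemma coef_shift (P : {poly K}) c n : (size P <= n.+1)%N ->
  (P \Po ('X + c%:P))`_n = P`_n.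
Proof.
rewrite leq_eqVlt => /predU1P[szP|lt_P]; last first.
  by rewrite !nth_default // size_comp_poly2 ?size_XaddC.
have := @lead_coef_comp K P ('X + c%:P); rewrite size_XaddC => /(_ isT).
rewrite !lead_coefE size_comp_poly2 ?size_XaddC // szP /= => ->.
by rewrite coefD coefX coefC /= addr0 expr1n mulr1.
Qed.

Lemma map_original_shift w (q : {poly F}) :
  (original_shift w q)^i = original_shift (iota w) q^i.
Proof.
rewrite !original_shiftE rmorphB /= map_comp_poly rmorphD /= map_polyX !map_polyC /=.
by rewrite horner_map.
Qed.

(** The derivative of [q] is [-A ((x - w)^l - A)^(M - 1)]. Its leading coefficient gives [A] and its
    second one gives [w], up to the invertible factors [l] and [M - 1]; for [M = 1] it is constant,
    whence the proviso on [w]. *)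
Lemma simple_descent p M l (q : {poly F}) w A : p \in [pchar K] -> (0 < M)%N ->
  (M * l).+1 = p -> A != 0 -> original_shift w q^i = 'X * ('X^l - A%:P) ^+ M ->
  in_base A /\ ((1 < M)%N -> in_base w).
Proof.
move=> charKp M_gt0 Mlp A_neq0 qE.
have dqE : q^`()^i = - A *: (('X - w%:P) ^+ l - A%:P) ^+ M.-1.
  have := deriv_original_shift w q^i; rewrite qE (deriv_simple_form _ charKp) //.
  move/(congr1 (comp_poly ('X - w%:P))).
  rewrite /= comp_polyXaddC_K -deriv_map => <-.
  by rewrite comp_polyZ !rmorphXn /= comp_polyB comp_polyC rmorphXn /= comp_polyX.
have l_gt0 : (0 < l)%N.
  by case: l Mlp {qE dqE} => //; rewrite muln0 => p1; have := pcharf_prime charKp; rewrite -p1.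
case: l l_gt0 Mlp qE dqE => // l _ Mlp qE; set R := _ - A%:P => dqE.
have szX : size (('X - w%:P) ^+ l.+1) = l.+2 by rewrite size_exp_XsubC.
have ltA : (size (- A%:P : {poly K}) < l.+2)%N.
  by rewrite size_polyN size_polyC (leq_ltn_trans (leq_b1 _)).
have R_m : R \is monic.
  by rewrite monicE lead_coefDl ?szX // -monicE rpredX // monicXsubC.
have szR : size R = l.+2 by rewrite size_polyDl ?szX.
have A_base : in_base A.
  rewrite -[A]opprK; apply: in_baseN; have /monicP := R_m.
  have : lead_coef (q^`()^i) = - A.
    by rewrite dqE lead_coefZ (monicP _) ?mulr1 // rpredX.
  by rewrite lead_coefE => <- _; apply: in_base_coef.
split=> // M_gt1; case: M M_gt1 M_gt0 Mlp qE dqE => [|[|M]] // _ _ Mlp qE dqE.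
have := in_base_coef q^`() (l + l.+1 * M).
have nA : - A != 0 by rewrite oppr_eq0.
have natK k : (0 < k < p)%N -> k%:R != 0 :> K by apply: natf_neq0_lt charKp.
have M_neq0 : M.+1%:R != 0 :> K by apply: natK; rewrite -Mlp; nia.
have l_neq0 : l.+1%:R != 0 :> K by apply: natK; rewrite -Mlp; nia.
rewrite dqE coefZ /= coef_exp_subtop // -mulr_natl.
move=> /in_base_mulI/(_ nA (in_baseN A_base)).
move=> /in_base_mulI/(_ M_neq0 (in_base_nat _)).
rewrite /R coefB coef_XsubC_exp coefC addrC => /in_base_addI.
(* Here [l] is the exponent minus one; only for exponent [1] does the constant [A] enter the second
   coefficient. *)
have : in_base (- (if l == 0%N then A else 0)).
  by apply: in_baseN; case: ifP => // _; apply: (in_base_nat 0).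
move=> Ab /(_ Ab); rewrite -mulr_natl.
by move=> /in_base_mulI/(_ l_neq0 (in_base_nat _))/in_baseN; rewrite opprK.
Qed.

(** The degree of [q'] is at most [p - 2], because [p q_p = 0]. So its coefficient of degree [p - 2]
    is unchanged by a shift, even one outside [F], and it determines the coefficient of degree
    [p - 1] of the shifted polynomial. *)
Lemma in_base_shift_coef p (q : {poly F}) w : p \in [pchar K] -> (size q <= p.+1)%N ->
  in_base (original_shift w q^i)`_p.-1.
Proof.
move=> charKp szq; have p_pr := pcharf_prime charKp.
have := prime_gt1 p_pr; case pE: p => [|[|n]] // _ /=.
have dcoef : (original_shift w q^i)^`()`_n = (q^`()^i)`_n.
  rewrite deriv_original_shift deriv_map; apply: coef_shift.
  rewrite size_map_poly; apply/leq_sizeP => j; rewrite leq_eqVlt => /predU1P[<-|lt_j].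
    rewrite coef_deriv; apply: (fmorph_inj iota).
    by rewrite rmorphMn -mulr_natr -pE (pcharf0 charKp) mulr0 rmorph0.
  by rewrite coef_deriv nth_default ?mul0rn // (leq_trans szq) // pE.
have := in_base_coef q^`() n; rewrite -dcoef coef_deriv -mulr_natl.
move=> /in_base_mulI; apply; last exact: in_base_nat.
by apply: (natf_neq0_lt charKp); rewrite pE /=.
Qed.

(** In characteristic [p] the linear factor [(p - m)(x - b) + m x] reduces to the constant
    [-(p - m) b]. *)
Lemma deriv_multiple_right p m (a b : K) : p \in [pchar K] -> (0 < m < p)%N ->
  (multiple_right p a b m)^`() =
  - ((b ^+ p - a) * b ^- p * b *+ (p - m)) *:
    ('X^((p - m).-1) * ('X - b%:P) ^+ m.-1).
Proof.
move=> charKp /andP[m_gt0 lt_mp].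
rewrite /multiple_right derivD derivZ derivB (deriv_Xp charKp) subr0 add0r.
have ms_gt0 : (0 < p - m)%N by rewrite subn_gt0.
have msm : ((p - m)%:R + m%:R : {poly K}) = 0.
  by rewrite -natrD subnK ?(ltnW lt_mp) // -polyC_natr (pcharf0 charKp).
move: ms_gt0 msm; set c := _ * b ^- p.
case: (p - m)%N => // ms _ msm; case: m m_gt0 {lt_mp} msm => // m _ msm.
rewrite derivM derivXn deriv_exp derivXsubC mul1r /=.
rewrite -!mul_polyC polyCN polyCMn !polyCM exprS exprSr.
rewrite -['X^ms *+ _]mulr_natr -[_ ^+ m *+ _]mulr_natr -[_ * b%:P *+ _]mulr_natr.
have -> : ms.+1%:R = - m.+1%:R :> {poly K} by apply/eqP; rewrite -addr_eq0 msm.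
by ring.
Qed.

(** The coefficients of degree [p - 1] of the shifted [g], [gs] and [h] give [a], [b^p - a] and then
    [b]. The shift comes from the zeros of [h'], whose sum is [(p - m - 1) w + (m - 1)(w + b) = -2 w
    + (m - 1) b]. *)
Lemma multiple_descent p m (g h gs : {poly F}) w wg wgs a b :
  p \in [pchar K] -> size g = p.+1 -> size h = p.+1 -> size gs = p.+1 ->
  b != 0 -> a != 0 -> a != b ^+ p -> (1 < m < p.-1)%N ->
  original_shift wg g^i = multiple_left p a m ->
  original_shift w h^i = multiple_right p a b m ->
  original_shift wgs gs^i = multiple_left_star p a b m ->
  [/\ in_base a, in_base b & in_base w].
Proof.
move=> charKp szg szh szgs b_neq0 a_neq0 ab_neq m_lt gE hE gsE.
have p_gt1 := prime_gt1 (pcharf_prime charKp).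
have natK k : (0 < k < p)%N -> k%:R != 0 :> K by apply: natf_neq0_lt charKp.
have m_neq0 : m%:R != 0 :> K by apply: natK; move: m_lt; clear; lia.
have ms_neq0 : (p - m)%:R != 0 :> K by apply: natK; move: m_lt p_gt1; clear; lia.
have top k n c : (0 < k)%N -> (n + k = p)%N ->
    (('X^n * ('X - c%:P) ^+ k) : {poly K})`_p.-1 = - (k%:R * c).
  case: k => // k _ <-; rewrite addnS /= coefXnM ltnNge leq_addr /= addKn.
  by rewrite coef_XsubC_exp mulNrn mulr_natl.
have a_base : in_base a.
  have := @in_base_shift_coef p g wg charKp; rewrite szg gE /multiple_left.
  rewrite top; [|by move: m_lt p_gt1; clear; lia..].
  by move=> /(_ (leqnn _))/in_baseN; rewrite opprK => /in_base_mulI; apply; last exact: in_base_nat.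
have as_base : in_base (b ^+ p - a).
  have := @in_base_shift_coef p gs wgs charKp; rewrite szgs gsE /multiple_left_star.
  rewrite top; [|by move: m_lt p_gt1; clear; lia..].
  by move=> /(_ (leqnn _))/in_baseN; rewrite opprK => /in_base_mulI; apply; last exact: in_base_nat.
have bp_base : in_base (b ^+ p) by rewrite -(subrK a (b ^+ p)); apply: in_baseD.
set c := (b ^+ p - a) * b ^- p.
have c_base : in_base c by apply: in_baseM => //; apply: in_baseV.
have c_neq0 : c != 0 by rewrite mulf_neq0 ?invr_eq0 ?expf_neq0 // subr_eq0 eq_sym.
have b_base : in_base b.
  have := @in_base_shift_coef p h w charKp; rewrite szh hE /multiple_right -/c.
  rewrite coefD coefZ coefB top; [|by move: m_lt p_gt1; clear; lia..].
  rewrite coefXn ltn_eqF ?prednK ?(ltnW p_gt1) // add0r subr0.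
  move=> /(_ (leqnn _))/in_base_mulI/(_ c_neq0 c_base)/in_baseN; rewrite opprK.
  by move=> /in_base_mulI; apply; last exact: in_base_nat.
split=> //.
pose k := - (c * b *+ (p - m)).
have k_base : in_base k.
  apply: in_baseN; rewrite -mulr_natr.
  by apply: in_baseM; [apply: in_baseM | apply: in_base_nat].
have k_neq0 : k != 0.
  by rewrite oppr_eq0 -mulr_natr; apply: mulf_neq0 => //; apply: mulf_neq0.
have dhE : h^`()^i = k *: (('X - w%:P) ^+ (p - m).-1 * ('X - (w + b)%:P) ^+ m.-1).
  have := deriv_original_shift w h^i; rewrite hE deriv_multiple_right //; last first.
    by move: m_lt; clear; lia.
  move/(congr1 (comp_poly ('X - w%:P))).
  rewrite /= comp_polyXaddC_K -deriv_map -/c => <-.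
  rewrite comp_polyZ comp_polyM !rmorphXn /= comp_polyB comp_polyC comp_polyX.
  by rewrite polyCD opprD addrA.
have := in_base_coef h^`() ((p - m - 2) + (m - 2)).+1.
rewrite dhE coefZ => /in_base_mulI/(_ k_neq0 k_base).
have -> : (p - m).-1 = (p - m - 2).+1 by move: m_lt; clear; lia.
have -> : m.-1 = (m - 2).+1 by move: m_lt; clear; lia.
rewrite coefM_subtop ?size_exp_XsubC ?rpredX ?monicXsubC // !coef_XsubC_exp.
have two_neq0 : 2%:R != 0 :> K by apply: natK; move: m_lt; clear; lia.
set n1 := (p - m - 2).+1; set n2 := (m - 2).+1 => sum_base.
apply: (in_base_mulI (x := 2%:R)) => //; last exact: in_base_nat.
have -> : 2%:R * w = (- w *+ n1 - (w + b) *+ n2) + n2%:R * b.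
  have n12 : n1%:R = - (2%:R + n2%:R) :> K.
    apply/eqP; rewrite -addr_eq0 -!natrD (_ : (_ + _)%N = p) ?(pcharf0 charKp) //.
    by rewrite /n1 /n2; move: m_lt; clear; lia.
  by rewrite mulNrn -[w *+ n1]mulr_natl n12 -[_ *+ n2]mulr_natl; ring.
by apply: in_baseD; [rewrite -mulNrn | apply: in_baseM => //; apply: in_base_nat].
Qed.
End Descent.

(** * Two-element sets *)

Section PairSets.
Variable T : eqType.

Lemma card2P (A : set T) : (A #= `I_2)%card ->
  exists x y, x != y /\ A = [set x; y]%classic.
Proof.
move=> /card_set_bijP[f [f_fun f_inj f_surj]].
have [x Ax fx] := f_surj 0%N isT; have [y Ay fy] := f_surj 1%N isT.
exists x, y; split; first by apply/eqP => xy; move: fx; rewrite xy fy.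
apply/seteqP; split=> z /=; last by case=> ->.
move=> Az; have : (f z < 2)%N := f_fun z Az.
case fz: (f z) => [|[|]] // _; [left|right]; apply: f_inj; rewrite ?inE //.
  by rewrite fz fx.
by rewrite fz fy.
Qed.

Lemma card_set2 (x y : T) : x != y -> ([set x; y] #= `I_2)%card.
Proof.
move=> xy; apply/card_set_bijP; exists (fun z => (z != x) : nat); split.
- by move=> z _ /=; case: (z != x).
- move=> z z'; rewrite !inE /= => -[->|->] [->|->] //; rewrite eqxx eq_sym xy //.
- move=> [|[|n]] // _; [exists x|exists y] => //=; rewrite ?eqxx //; [by left|by right|].
  by rewrite eq_sym xy.
Qed.

Lemma card_ge2 (A : set T) (x y : T) : A x -> A y -> x != y -> (`I_2 #<= A)%card.
Proof.
move=> Ax Ay xy; apply: (card_le_trans (B := [set x; y]%classic)).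
  by have := card_set2 xy; rewrite card_eq_le => /andP[].
by apply: subset_card_le => z [] ->.
Qed.
End PairSets.

(** * Frobenius collisions and vanishing derivatives *)

Section Frobenius.
Variables (F : fieldType) (p : nat).
Hypothesis charFp : p \in [pchar F].
Implicit Types f g h : {poly F}.

Let p_pr : prime p := pcharf_prime charFp.

Lemma Xp_comp h : 'X^p \Po h = h ^+ p.
Proof. by rewrite rmorphXn /= comp_polyX. Qed.

Lemma map_Frobenius_comp h : map_poly (pFrobenius_aut charFp) h \Po 'X^p = h ^+ p.
Proof.
have charP : p \in [pchar {poly F}] by rewrite pchar_poly.
rewrite -[RHS](pFrobenius_autE charP) -[h in RHS]coefK poly_def rmorph_sum /=.
rewrite comp_polyE size_map_poly; apply: eq_bigr => i _.
by rewrite coef_map /= !pFrobenius_autE exprZn -!exprM mulnC.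
Qed.

Lemma comp_poly_inj (P Q q : {poly F}) : (1 < size q)%N -> P \Po q = Q \Po q -> P = Q.
Proof.
move=> q1 /eqP; rewrite -subr_eq0 -comp_polyB -lead_coef_eq0 lead_coef_comp //.
rewrite mulf_eq0 lead_coef_eq0 subr_eq0 => /orP[/eqP//|].
by rewrite expf_eq0 lead_coef_eq0 -size_poly_eq0 => /andP[_ /eqP sz]; rewrite sz in q1.
Qed.

Lemma exp_char_inj (P Q : {poly F}) : P ^+ p = Q ^+ p -> P = Q.
Proof.
have charP : [pchar {poly F}].-nat p by rewrite pnatE // pchar_poly.
move=> /eqP; rewrite -subr_eq0 -exprNn_pchar // -exprDn_pchar // expf_eq0 subr_eq0.
by case/andP => _ /eqP.
Qed.

Lemma deriv_eq0 (q : {poly F}) : q \is monic -> size q = p.+1 -> q`_0 = 0 -> q^`() = 0 -> q = 'X^p.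
Proof.
move=> q_m szq q0 dq; apply/polyP => k; rewrite coefXn.
case: (ltngtP k p) => [lt_kp|gt_kp|->].
- case: k lt_kp => // k lt_kp.
  have : q`_k.+1 * k.+1%:R = 0 by rewrite mulr_natr -coef_deriv dq coef0.
  by move=> /eqP; rewrite mulf_eq0 (negPf (natf_neq0_lt charFp _)) ?orbF // => /eqP.
- by rewrite nth_default ?szq.
- by have /monicP := q_m; rewrite lead_coefE szq.
Qed.

Lemma decomposition_size f gh : monic_original (p ^ 2) f -> decomposition f gh ->
  monic_original p gh.1 /\ monic_original p gh.2.
Proof.
case: gh => g h [_ _ szf] [[d d1 g_o] [e e1 h_o] /= fE] /=.
have [_ _ szg] := g_o; have [_ _ szh] := h_o.
have de : (d * e = p ^ 2)%N.
  by have := size_comp_poly g h; rewrite fE szf szg szh.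
have /(dvdn_pfactor _ _ p_pr)[k k2 dE] : (d %| p ^ 2)%N by rewrite -de dvdn_mulr.
have dp : d = p.
  case: k k2 dE => [|[|[|]]] // _ dE; first by rewrite dE in d1.
  have : (e = 1)%N.
    apply/eqP; rewrite -(eqn_pmul2l (_ : 0 < d)%N) ?(ltnW d1) // de dE muln1 //.
  by move=> e_1; rewrite e_1 in e1.
have ep : e = p.
  by apply/eqP; rewrite -(eqn_pmul2l (prime_gt0 p_pr)) -[X in (X * e)%N]dp de.
by rewrite -{1}dp -ep.
Qed.

Lemma frobenius_collision_exists f : frobenius_collision charFp f ->
  exists D, collision 2 f D.
Proof.
case=> h [[h_m h0 szh] h_neq fE fE'].
have p_gt1 := prime_gt1 p_pr.
set phi := map_poly _ h in fE'.
have Xp_o : monic_original p ('X^p : {poly F}).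
  split; rewrite ?monicXn ?size_polyXn //.
  by rewrite coefXn; case: p p_gt1.
have phi_o : monic_original p phi.
  split; rewrite ?map_monic //; last by rewrite size_map_poly.
  by rewrite coef_map h0 /= pFrobenius_aut0.
exists [set ('X^p, h); (phi, 'X^p)]%classic; split.
- by apply: card_set2; apply/eqP => -[_ /h_neq].
- by move=> gh [] ->; split; by [exists p | rewrite /= -?fE -?fE'].
- by move=> gh gh' [] -> [] -> /=; rewrite ?size_polyXn ?(let: And3 _ _ E := phi_o in E).
Qed.

Lemma frobenius_deriv f : frobenius_collision charFp f -> f^`() = 0.
Proof.
by case=> h [_ _ -> _]; rewrite deriv_comp (deriv_Xp charFp) comp_poly0 mul0r.
Qed.

Lemma frobenius_of_deriv f g h gs hs : monic_original (p ^ 2) f -> (g, h) != (gs, hs) ->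
  decomposition f (g, h) -> decomposition f (gs, hs) -> f^`() = 0 ->
  frobenius_collision charFp f.
Proof.
move=> f_o neq dec decs df.
have [[/= g_m g0 szg] [/= h_m h0 szh]] := decomposition_size f_o dec.
have [[/= gs_m gs0 szgs] [/= hs_m hs0 szhs]] := decomposition_size f_o decs.
have [_ _ /= fE] := dec; have [_ _ /= fsE] := decs.
have hhs : h != hs.
  apply: contra_neq neq => hhs; rewrite -hhs in fsE *; congr (_, _).
  by apply: (@comp_poly_inj _ _ h); rewrite ?szh ?ltnS ?prime_gt0 // fE.
have Xp_case (P q : {poly F}) : P \is monic -> size P = p.+1 -> P`_0 = 0 ->
    q \is monic -> size q = p.+1 -> q`_0 = 0 -> P \Po q = f -> P = 'X^p \/ q = 'X^p.
  move=> P_m szP P0 q_m szq q0 PqE; move: df; rewrite -PqE deriv_comp => /eqP.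
  rewrite mulf_eq0 => /orP[/eqP dP|/eqP dq]; [left|right]; apply: deriv_eq0 => //.
  by apply: (@comp_poly_inj _ _ q); rewrite ?comp_poly0 // szq ltnS prime_gt0.
have frob q : q \is monic -> size q = p.+1 -> q`_0 = 0 -> q <> 'X^p -> f = 'X^p \Po q ->
    frobenius_collision charFp f.
  move=> q_m szq q0 q_neq f_q; exists q; split=> //.
  by rewrite map_Frobenius_comp -Xp_comp.
(* If both left components are [x^p], then [h^p = hs^p] and [h = hs]; if both right components are,
   [h = hs] at once. In the mixed cases the right component of the pair starting with [x^p] serves
   as [h0]. *)
have [gX|hX] := Xp_case g h g_m szg g0 h_m szh h0 fE;
  have [gsX|hsX] := Xp_case gs hs gs_m szgs gs0 hs_m szhs hs0 fsE.
- case/eqP: hhs; apply: exp_char_inj.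
  by rewrite -(Xp_comp h) -(Xp_comp hs) -{1}gX -gsX fE fsE.
- apply: (frob h) => //; last by rewrite -gX fE.
  by move=> hX; rewrite hX hsX eqxx in hhs.
- apply: (frob hs) => //; last by rewrite -gsX fsE.
  by move=> hsX; rewrite hX hsX eqxx in hhs.
- by rewrite hX hsX eqxx in hhs.
Qed.
End Frobenius.

(** * Collisions over the base field *)
(** Powers of [x] and of [x - b] split off from [h_M] and [h_M - a] respectively; the second
    factorisation uses [(x - b)^p = x^p - b^p] and [c + d = 1] for [c = (b^p - a) / b^p] and
    [d = a / b^p]. *)
Lemma multiple_comp (F : fieldType) p m (a b : F) : p \in [pchar F] -> b != 0 ->
  (0 < m < p)%N ->
  multiple_left p a m \Po multiple_right p a b m = multiple_poly p a b m.
Proof.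
move=> charFp b0 /andP[m_gt0 lt_mp].
rewrite /multiple_left comp_polyM !rmorphXn /= comp_polyB comp_polyX comp_polyC.
set ms := (p - m)%N; set c := (b ^+ p - a) * b ^- p; set d := a * b ^- p.
have p_pr := pcharf_prime charFp.
have cd : c%:P + d%:P = 1 :> {poly F}.
  by rewrite -polyCD /c /d -mulrDl subrK divff // expf_neq0.
have Xp : ('X : {poly F}) ^+ p = 'X^m * 'X^ms by rewrite -exprD subnKC // ltnW.
have Xbp : ('X - b%:P : {poly F}) ^+ p = ('X - b%:P) ^+ m * ('X - b%:P) ^+ ms.
  by rewrite -exprD subnKC // ltnW.
have Xb : ('X - b%:P : {poly F}) ^+ p = 'X^p - (b ^+ p)%:P.
  have charP : [pchar {poly F}].-nat p by rewrite pnatE // pchar_poly.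
  by rewrite exprDn_pchar // exprNn_pchar // rmorphXn.
have aE : a%:P = d%:P * (b ^+ p)%:P :> {poly F}.
  by rewrite -polyCM mulfVK // expf_neq0.
have cE : c%:P = 1 - d%:P :> {poly F} by rewrite -cd addrK.
have HE : multiple_right p a b m =
    'X^ms * ('X^m + c *: (('X - b%:P) ^+ m - 'X^m)).
  by rewrite /multiple_right -/c -/ms Xp -!mul_polyC; ring.
have HaE : multiple_right p a b m - a%:P =
    ('X - b%:P) ^+ m * ('X^ms + d *: (('X - b%:P) ^+ ms - 'X^ms)).
  rewrite /multiple_right -/c -/ms -!mul_polyC cE aE.
  rewrite [RHS](_ : _ = ('X - b%:P) ^+ m * 'X^ms
    + d%:P * (('X - b%:P) ^+ p - ('X - b%:P) ^+ m * 'X^ms)).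
    by rewrite Xb; ring.
  by rewrite Xbp; ring.
rewrite HaE HE /multiple_poly -/c -/d -/ms !exprMn -!exprM.
by rewrite [(ms * m)%N]mulnC; ring.
Qed.

Section Descend.
Variables (F : fieldType) (K : closedFieldType) (iota : {rmorphism F -> K}).
Variable p : nat.
Hypothesis charFp : p \in [pchar F].
Implicit Types (f g h gs hs q : {poly F}) (w : F).
Local Notation "q ^i" := (map_poly iota q) (at level 2).

Let p_pr : prime p := pcharf_prime charFp.

Let charKp : p \in [pchar K].
Proof. by rewrite (fmorph_pchar iota). Qed.

Lemma tame_collision_map g h gs hs : tame_collision p g h gs hs ->
  tame_collision p g^i h^i gs^i hs^i.
Proof.
move=> C; split; rewrite ?map_monic ?size_map_poly; try by case: C.
- by rewrite coef_map /= (tc_h0 C) rmorph0.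
- by rewrite coef_map /= (tc_hs0 C) rmorph0.
- by apply: contra_neq (tc_neq C); apply: map_inj_poly (fmorph_inj iota) (rmorph0 iota) _ _.
- by rewrite -!map_comp_poly (tc_comp C).
- by rewrite -map_comp_poly deriv_map map_poly_eq0 (tc_deriv C).
Qed.

Lemma tame_collision_of f g h gs hs : monic_original (p ^ 2) f ->
  (g, h) != (gs, hs) -> decomposition f (g, h) -> decomposition f (gs, hs) ->
  f^`() != 0 -> tame_collision p g h gs hs.
Proof.
move=> f_o neq dec decs df.
have [[/= g_m g0 szg] [/= h_m h0 szh]] := decomposition_size charFp f_o dec.
have [[/= gs_m gs0 szgs] [/= hs_m hs0 szhs]] := decomposition_size charFp f_o decs.
have [_ _ /= fE] := dec; have [_ _ /= fsE] := decs.
split=> //; rewrite ?fE ?fsE //.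
apply: contra_neq neq => hhs; rewrite -hhs in fsE *; congr (_, _).
by apply: (@comp_poly_inj _ _ _ h); rewrite ?szh ?ltnS ?prime_gt0 // fE.
Qed.

(** A nonlinear [v] has degree [p] by primality, so [h] and [hs] are affine functions of [v]; being
    monic with zero constant term, both are the same normalisation of [v]. *)
Lemma no_common_right_component g h gs hs : tame_collision p g h gs hs ->
  ~ common_right_component iota h hs.
Proof.
move=> C [v [u1 [u2 [v2 hE hsE]]]]; have CK := tame_collision_map C.
have size_u (u q : {poly K}) : size q = p.+1 -> q = u \Po v -> size u = 2%N /\ size v = p.+1.
  move=> szq qE; have := size_comp_poly u v; rewrite -qE szq /= => pE.
  have v_dvd : ((size v).-1 %| p)%N by rewrite pE dvdn_mull.
  move/primeP: (p_pr) => [_ /(_ _ v_dvd)/orP[/eqP|/eqP] vE].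
    by rewrite -ltnS in v2; case: (size v) v2 vE => [|[|[|]]].
  move: pE v2 vE (prime_gt0 p_pr); move: (size u) (size v); clear.
  by move=> [|[|[|n]]] [|m] //= pE _ vE p_gt0; rewrite ?vE in pE *; nia.
have [szu1 szv] := size_u u1 _ (tc_szh CK) hE.
have [szu2 _] := size_u u2 _ (tc_szhs CK) hsE.
have linear (u q : {poly K}) : size u = 2%N -> q \is monic -> q`_0 = 0 -> q = u \Po v ->
    q = (lead_coef v)^-1 *: (v - (v`_0)%:P).
  move=> szu q_m q0 qE.
  have uE : u = u`_1 *: 'X + (u`_0)%:P.
    apply/polyP => -[|[|k]]; rewrite coefD coefZ coefX coefC /= ?mulr0 ?mulr1 ?add0r ?addr0 //.
    by rewrite nth_default // szu.
  have vE : u \Po v = u`_1 *: v + (u`_0)%:P.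
    by rewrite {1}uE comp_polyD comp_polyZ comp_polyX comp_polyC.
  have u1E : u`_1 = (lead_coef v)^-1.
    have lv0 : lead_coef v != 0 by rewrite lead_coef_eq0 -size_poly_gt0 szv.
    have := lead_coef_comp u (ltnW v2); rewrite -qE (monicP q_m) szu (lead_coefE u) szu.
    by rewrite expr1 /= => E; apply: (mulIf lv0); rewrite -E mulVf.
  have u0E : u`_0 = - (u`_1 * v`_0).
    by apply/eqP; rewrite -addr_eq0; move/eqP: q0; rewrite qE vE coefD coefZ coefC addrC.
  by rewrite qE vE u0E u1E scalerBr polyCN -mul_polyC -[_ *: _%:P]mul_polyC polyCM.
have := tc_neq CK; rewrite (linear _ _ szu1 (tc_h CK) (tc_h0 CK) hE).
by rewrite (linear _ _ szu2 (tc_hs CK) (tc_hs0 CK) hsE) eqxx.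
Qed.

Lemma no_root_mult_dvd (q : {poly K}) c : q \is monic -> size q = p.+1 -> q^`() != 0 ->
  ~ has_root_mult_dvd p (q - c%:P).
Proof.
move=> q_m szq dq [z]; rewrite root_subC => /eqP <-; rewrite -/(ram q z).
have q1 : (1 < size q)%N by rewrite szq ltnS prime_gt0.
by rewrite gtnNdvd ?ram_gt0 // (ram_lt charKp).
Qed.

Lemma original_collision f g h gs hs : monic_original (p ^ 2) f ->
  decomposition f (g, h) -> decomposition f (gs, hs) ->
  tame_collision p g h gs hs -> has_original_collision iota p f.
Proof.
move=> f_o dec decs C; exists 1%N; rewrite expn1; split=> //.
have [_ _ /= fE] := dec.
have CK := tame_collision_map C; have [dg dh dgs dhs] := tc_deriv_neq0 CK.
exists g, h, gs, hs; split; split.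
- by apply: card_set2; apply/eqP => -[_ hhs]; have := tc_neq C; rewrite hhs eqxx.
- by move=> gh [] ->.
- by move=> gh gh' [] -> [] -> /=; rewrite ?(tc_szg C) ?(tc_szgs C).
- by rewrite -fE; apply: tc_deriv C.
- by rewrite (tc_szg C) (tc_szgs C) (tc_szh C) (tc_szhs C).
- exact: no_common_right_component C.
- by move=> c; split; apply: no_root_mult_dvd => //; case: CK.
- have [_ _ ->] := size_deriv_collision charFp (tc_g C) (tc_h C) (tc_gs C)
    (tc_hs C) (tc_szg C) (tc_szh C) (tc_szgs C) (tc_szhs C) (tc_h0 C) (tc_hs0 C)
    (tc_neq C) (tc_comp C) (tc_deriv C).
  by [].
Qed.

Lemma multiple_originalP f g h gs hs : decomposition f (g, h) ->
  tame_collision p g h gs hs ->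
  (exists c : K, no_simple_root (f^i - c%:P)) <->
  (exists c, multiple_value p g^i gs^i c).
Proof.
move=> [_ _ /= fE] C; have CK := tame_collision_map C.
have fiE : f^i = g^i \Po h^i by rewrite -fE map_comp_poly.
split=> -[c cP]; exists c; have iffc := no_simple_rootP charKp CK c.
  by apply/iffc; rewrite -fiE.
by rewrite /no_simple_root fiE; apply/iffc.
Qed.

Lemma multiple_case_of f g h gs hs : monic_original (p ^ 2) f ->
  decomposition f (g, h) -> decomposition f (gs, hs) -> tame_collision p g h gs hs ->
  (exists c, multiple_value p g^i gs^i c) ->
  multiple_case iota p f [set (g, h); (gs, hs)]%classic.
Proof.
move=> f_o dec decs C multC; split.
  split; first exact: original_collision C.
  exact: (multiple_originalP dec C).2.
have CK := tame_collision_map C; have [c cP] := multC; have [_ _ /= fE] := dec.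
have [m [w [a [b [[b0 a0 ab m_lt] gE hE gsE hsE]]]]] := multiple_form charKp CK cP.
have [[a' aE] [b' bE] [w' wE]] := multiple_descent charKp (tc_szg C) (tc_szh C)
  (tc_szgs C) b0 a0 ab m_lt gE hE gsE.
exists a', b', m, w'.
have inj := map_inj_poly (fmorph_inj iota) (rmorph0 iota).
subst a b w.
have E1 : original_shift h.[w'] g = multiple_left p a' m.
  apply: inj; rewrite map_original_shift -horner_map gE /multiple_left.
  by rewrite rmorphM !rmorphXn /= map_polyXsubC map_polyX.
have E2 : original_shift w' h = multiple_right p a' b' m.
  apply: inj; rewrite map_original_shift hE /multiple_right.
  rewrite rmorphD /= map_polyZ /= rmorphB /= [map_poly iota (_ * _)]rmorphM /=.
  rewrite !rmorphXn /= map_polyXsubC !map_polyX.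
  by rewrite rmorphM rmorphB /= fmorphV !rmorphXn.
have E3 : original_shift hs.[w'] gs = multiple_left_star p a' b' m.
  apply: inj; rewrite map_original_shift -horner_map gsE /multiple_left_star.
  by rewrite rmorphM !rmorphXn /= map_polyXsubC map_polyX [iota (_ - _)]rmorphB rmorphXn.
have E4 : original_shift w' hs = multiple_right_star p a' b' m.
  apply: inj; rewrite map_original_shift hsE /multiple_right_star.
  rewrite rmorphD /= map_polyZ /= rmorphB /= [map_poly iota (_ * _)]rmorphM /=.
  rewrite !rmorphXn /= map_polyXsubC !map_polyX.
  by rewrite rmorphM /= fmorphV !rmorphXn.
have b'0 : b' != 0 by move: b0; rewrite fmorph_eq0.
split.
- split=> //; first by move: a0; rewrite fmorph_eq0.
  by apply: contraNneq ab => ->; rewrite rmorphXn.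
- rewrite -fE -original_shift_comp E1 E2 multiple_comp //.
  by move: m_lt; clear; lia.
- by rewrite image_setU !image_set1 /pair_shift /= E1 E2 E3 E4.
Qed.
End Descend.

(** * Simple collisions over the base field *)

Lemma mup_exp (K : fieldType) (q : {poly K}) z n : q != 0 ->
  mup z (q ^+ n) = (n * mup z q)%N.
Proof.
move=> q0; elim: n => [|n IHn]; first by rewrite expr0 mul0n mupNroot // root1.
by rewrite exprS mupM ?expf_neq0 // IHn mulSn.
Qed.

Lemma exp_monic_inj (K : closedFieldType) (P Q : {poly K}) n : (0 < n)%N ->
  P \is monic -> Q \is monic -> P ^+ n = Q ^+ n -> P = Q.
Proof.
move=> n_gt0 P_m Q_m PQ; apply: eq_mup => // z.
have /eqP := congr1 (mup z) PQ; rewrite !mup_exp ?monic_neq0 //.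
by rewrite eqn_pmul2l // => /eqP.
Qed.

(** With [D = x^l - A], the power [D^(M l + 1)] is [D^p = x^(l p) - A^p], which leaves a trinomial
    in [x^l]. *)
Lemma simple_comp (F : fieldType) p M l (A B : F) : p \in [pchar F] -> (M * l).+1 = p ->
  ('X * ('X^l - B%:P) ^+ M) \Po ('X * ('X^l - A%:P) ^+ M) =
  'X * ('X^(l * p.+1) - (A ^+ p + B) *: 'X^l + (A * B)%:P) ^+ M.
Proof.
move=> charFp Mlp; have p_pr := pcharf_prime charFp.
rewrite comp_polyM rmorphXn /= comp_polyB comp_polyC comp_polyX rmorphXn /= comp_polyX.
set Y : {poly F} := 'X^l; set D := Y - A%:P.
have charP : [pchar {poly F}].-nat p by rewrite pnatE // pchar_poly.
have Dp : D * D ^+ (M * l) = Y ^+ p - (A ^+ p)%:P.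
  by rewrite -exprS Mlp exprDn_pchar // exprNn_pchar // rmorphXn.
rewrite exprMn -exprM -/Y -mulrA -exprMn; congr (_ * _ ^+ M).
have -> : 'X^(l * p.+1) = Y * Y ^+ p :> {poly F} by rewrite -exprS -exprM.
rewrite -mul_polyC polyCD polyCM.
transitivity (Y * (D * D ^+ (M * l)) - B%:P * D); first by ring.
by rewrite Dp /D; ring.
Qed.

(** By [simple_comp] both invariants are, up to sign, coefficients of a trinomial; being monic, it
    is recovered from its [M]-th power over [K]. *)
Lemma simple_comp_invariants (F : fieldType) (K : closedFieldType)
    (iota : {rmorphism F -> K}) p M l (A B As Bs : F) :
  p \in [pchar F] -> (0 < M)%N -> (M * l).+1 = p ->
  ('X * ('X^l - B%:P) ^+ M) \Po ('X * ('X^l - A%:P) ^+ M) =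
  ('X * ('X^l - Bs%:P) ^+ M) \Po ('X * ('X^l - As%:P) ^+ M) ->
  A ^+ p + B = As ^+ p + Bs /\ A * B = As * Bs.
Proof.
move=> charFp M_gt0 Mlp; rewrite !(simple_comp _ _ charFp Mlp).
have X0 : 'X != 0 :> {poly F} by rewrite polyX_eq0.
move/(mulfI X0).
have p_pr := pcharf_prime charFp.
have l_gt0 : (0 < l)%N.
  by case: l Mlp => //; rewrite muln0 => p1; rewrite -p1 in p_pr.
pose T (E N : F) : {poly F} := 'X^(l * p.+1) - E *: 'X^l + N%:P.
rewrite -/(T (A ^+ p + B) (A * B)) -/(T (As ^+ p + Bs) (As * Bs)).
have T_m E N : T E N \is monic.
  have lt_l : (size (- (E *: 'X^l) : {poly F}) < size ('X^(l * p.+1) : {poly F}))%N.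
    rewrite size_polyN (leq_ltn_trans (size_scale_leq _ _)) // !size_polyXn ltnS.
    by rewrite -{1}[l]muln1 ltn_pmul2l // ltnS prime_gt0.
  rewrite monicE lead_coefDl ?lead_coefDl ?lead_coefXn // size_polyDl //.
  rewrite size_polyC size_polyXn (leq_ltn_trans (leq_b1 _)) // ltnS muln_gt0 l_gt0.
  by [].
move=> TE.
have {TE} TE : T (A ^+ p + B) (A * B) = T (As ^+ p + Bs) (As * Bs).
  apply: (map_inj_poly (fmorph_inj iota) (rmorph0 iota)).
  by apply: (exp_monic_inj M_gt0); rewrite ?map_monic // -!rmorphXn TE.
have TN E N : (T E N)`_0 = N.
  rewrite /T coefD coefB coefZ !coefXn coefC /= !ltn_eqF ?muln_gt0 ?l_gt0 //.
  by rewrite mulr0 subrr add0r.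
have TEc E N : (T E N)`_l = - E.
  have l_neq : (l == l * p.+1)%N = false.
    by rewrite ltn_eqF // -{1}[l]muln1 ltn_pmul2l // ltnS prime_gt0.
  rewrite /T coefD coefB coefZ !coefXn coefC l_neq eqxx eqn0Ngt l_gt0 /=.
  by rewrite mulr1 addr0 sub0r.
split; last by rewrite -[LHS](TN (A ^+ p + B)) TE TN.
by apply: oppr_inj; rewrite -[LHS](TEc _ (A * B)) TE TEc.
Qed.

(** For [E != 0] and [eps = 1] the equations [u s^p = E] and [u s^(p + 1) = N] force [s = N / E];
    for [E = 0] take [eps = 0] and normalise [s = 1]. *)
Lemma simple_parameters (F : fieldType) p (E N : F) : N != 0 ->
  exists u s eps, [/\ u != 0, s != 0, eps = 0 \/ eps = 1,
    eps * u * s ^+ p = E & u * s ^+ p.+1 = N].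
Proof.
move=> N0; have [->|E0] := eqVneq E 0.
  exists N, 1, 0; split; rewrite ?oner_neq0 ?expr1n ?mulr1 ?mul0r //; by left.
have s0 : N / E != 0 by rewrite mulf_neq0 ?invr_eq0.
have sp0 : (N / E) ^+ p != 0 by rewrite expf_neq0.
exists (E / (N / E) ^+ p), (N / E), 1; split; rewrite ?mulf_neq0 ?invr_eq0 //; first by right.
  by rewrite mul1r divfK.
by rewrite exprSr mulrA divfK // mulrC divfK.
Qed.

Section SimpleCase.
Variables (F : fieldType) (K : closedFieldType) (iota : {rmorphism F -> K}).
Variable p : nat.
Hypothesis charFp : p \in [pchar F].
Implicit Types (f g h gs hs q : {poly F}) (w : F).
Local Notation "q ^i" := (map_poly iota q) (at level 2).

Let p_pr : prime p := pcharf_prime charFp.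

Let charKp : p \in [pchar K].
Proof. by rewrite (fmorph_pchar iota). Qed.

(** The shift enters through the hypothesis [z = iota w], since for [M = 1] its rationality does not
    come from the coefficients of [q]. *)
Lemma simple_form_descent M l q (z : K) : (0 < M)%N -> (M * l).+1 = p ->
  q \is monic -> size q = p.+1 -> simple_over M l q^i z ->
  ((1 < M)%N -> in_base iota z) /\
  exists2 A, A != 0 &
    forall w, z = iota w -> original_shift w q = 'X * ('X^l - A%:P) ^+ M.
Proof.
move=> M_gt0 Mlp q_m szq sq.
have qi_m : q^i \is monic by rewrite map_monic.
have szqi : size q^i = p.+1 by rewrite size_map_poly.
have [AK AK0 qE] := simple_form charKp M_gt0 Mlp qi_m szqi sq.
have [[A AE] z_base] := simple_descent charKp M_gt0 Mlp AK0 qE.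
split=> //; exists A => [|w zE]; first by move: AK0; rewrite AE fmorph_eq0.
apply: (map_inj_poly (fmorph_inj iota) (rmorph0 iota)).
rewrite map_original_shift -zE qE AE.
by rewrite rmorphM !rmorphXn /= rmorphB /= !rmorphXn /= map_polyC !map_polyX.
Qed.

Lemma original_shift_inj w (P Q : {poly F}) : P`_0 = 0 -> Q`_0 = 0 ->
  original_shift w P = original_shift w Q -> P = Q.
Proof.
move=> P0 Q0; rewrite !original_shiftE => PQ.
have : ((P - Q) \Po ('X + w%:P)) \Po ('X - w%:P) = (P.[w] - Q.[w])%:P.
  have -> : (P - Q) \Po ('X + w%:P) = (P.[w] - Q.[w])%:P.
    by rewrite comp_polyB polyCB -(subrK P.[w]%:P (P \Po _)) PQ; ring.
  by rewrite comp_polyC.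
rewrite comp_polyXaddC_K => PQc; apply/eqP; rewrite -subr_eq0 PQc.
by have := congr1 (fun R : {poly F} => R`_0) PQc;
  rewrite coefB P0 Q0 subrr coefC /= => <-.
Qed.

Lemma simple_case_of f g h gs hs : monic_original (p ^ 2) f ->
  decomposition f (g, h) -> decomposition f (gs, hs) -> tame_collision p g h gs hs ->
  ~ (exists c, multiple_value p g^i gs^i c) ->
  simple_case iota p f [set (g, h); (gs, hs)]%classic.
Proof.
move=> f_o dec decs C no_mult; split.
  split; first exact: original_collision C.
  by move/(multiple_originalP iota charFp dec C).
have CK := tame_collision_map iota C.
have [_ _ /= fE] := dec; have [_ _ /= fsE] := decs.
have [|M [l [wK [[M_gt0 M1 Mlp] [sh shs sg sgs]]]]] := simple_structure charKp CK.
  by move=> c cP; apply: no_mult; exists c.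
have [h_base [A A0 hE]] := simple_form_descent M_gt0 Mlp (tc_h C) (tc_szh C) sh.
have [_ [As As0 hsE]] := simple_form_descent M_gt0 Mlp (tc_hs C) (tc_szhs C) shs.
have [_ [B B0 gE]] := simple_form_descent M_gt0 Mlp (tc_g C) (tc_szg C) sg.
have [_ [Bs Bs0 gsE]] := simple_form_descent M_gt0 Mlp (tc_gs C) (tc_szgs C) sgs.
have [w wE] : in_base iota wK.
  have [/h_base //|le1] := ltnP 1 M; exists 0; rewrite rmorph0; apply: M1.
  by apply/eqP; rewrite eqn_leq le1.
move: (hE w wE) (hsE w wE) (gE h.[w]) (gsE hs.[w]) => {hE hsE gE gsE}.
rewrite wE !horner_map => hE hsE /(_ erefl) gE /(_ erefl) gsE.
have l_def : (p.-1 %/ M)%N = l by rewrite -Mlp /= mulKn.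
have fwE := original_shift_comp w g h; have fswE := original_shift_comp w gs hs.
rewrite fE gE hE in fwE; rewrite fsE gsE hsE in fswE.
have [eqE eqN] := simple_comp_invariants iota charFp M_gt0 Mlp (etrans fwE (esym fswE)).
have N0 : A * B != 0 by rewrite mulf_neq0.
have [u [s [eps [u0 s0 eps01 uE uN]]]] := simple_parameters p (A ^+ p + B) N0.
(* With [E = A^p + B] and [N = A B], eliminating [y] gives [x^(p + 1) - E x + N = 0]; division by
   [s^(p + 1)] shows that [t = x / s] lies in [T]. *)
have param x y : x != 0 -> x ^+ p + y = A ^+ p + B -> x * y = A * B ->
    [/\ s * (x / s) = x, u * s ^+ p * (x / s)^-1 = y & simple_params p u eps (x / s)].
  move=> x0 xyE xyN; have xs : s * (x / s) = x by rewrite mulrC divfK.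
  split=> //.
    apply: (mulIf x0); rewrite invf_div mulrA divfK // [y * x]mulrC xyN -uN.
    by rewrite exprSr mulrA.
  rewrite /simple_params /=; apply: (mulIf (expf_neq0 p.+1 s0)); rewrite mul0r.
  rewrite mulrDl mulrBl -exprMn divfK // uN exprSr.
  rewrite [eps * u * _ * _](_ : _ = eps * u * s ^+ p * (s * (x / s))); last by rewrite exprS; ring.
  by rewrite uE xs -xyE -xyN; ring.
have [At Bt tT] := param A B A0 erefl erefl.
have [Ast Bst tsT] := param As Bs As0 (esym eqE) (esym eqN).
have AAs : A != As.
  apply: contraTneq (tc_neq C) => AAs; rewrite negbK; apply/eqP.
  by apply: (@original_shift_inj w) (tc_h0 C) (tc_hs0 C) _; rewrite hE hsE AAs.
exists u, s, eps, M, w; split.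
- by split=> //; rewrite -Mlp /= dvdn_mulr.
- by rewrite -fwE (simple_comp _ _ charFp Mlp) /simple_poly l_def uE uN.
- move=> _ [gh /= [] -> <-]; [exists (A / s) => // | exists (As / s) => //].
    by rewrite /simple_left /simple_right l_def /pair_shift /= gE hE At Bt.
  by rewrite /simple_left /simple_right l_def /pair_shift /= gsE hsE Ast Bst.
- apply: card_ge2 tT tsT _.
  by apply: contra_neq AAs => /(mulIf (_ : s^-1 != 0)) -> //; rewrite invr_eq0.
Qed.
End SimpleCase.

(** Exclusion rests on two properties of [f]: its derivative vanishes in the Frobenius case only,
    and a value without simple roots exists in the multiple case but not in the simple one.
    Conversely, a Frobenius collision exhibits two decompositions, and in the other two cases
    originality includes a 2-collision. *)
Theorem theorem5p5 (F : fieldType) (K : closedFieldType)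
    (iota : {rmorphism F -> K}) (iota_closure : algebraic_closure_of iota)
    (p : nat) (charFp : p \in [pchar F]) (perfF : perfect_field F)
    (f : {poly F}) (f_orig : monic_original (p ^ 2) f) :
  (forall C : set ({poly F} * {poly F}), collision 2 f C ->
     exactly_one3 (frobenius_collision charFp f)
                  (simple_case iota p f C)
                  (multiple_case iota p f C)) /\
  (forall C : set ({poly F} * {poly F}),
     frobenius_collision charFp f \/ simple_case iota p f C \/
       multiple_case iota p f C ->
     exists D : set ({poly F} * {poly F}), collision 2 f D).
Proof.
have collision_of : has_original_collision iota p f -> exists D, collision 2 f D.
  by case=> e [_ [g [h [gs [hs [coll _]]]]]]; exists [set (g, h); (gs, hs)].
split=> [C [C2 C_dec C_size]|C]; last first.
  case=> [/frobenius_collision_exists //|].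
  by case=> -[[orig _] _]; apply: collision_of orig.
have [[g h] [[gs hs] [neq CE]]] := card2P C2.
have dec : decomposition f (g, h) by apply: C_dec; rewrite CE; left.
have decs : decomposition f (gs, hs) by apply: C_dec; rewrite CE; right.
have original_deriv : has_original_collision iota p f -> f^`() != 0.
  by case=> e [_ [g' [h' [gs' [hs' [_ [df _ _ _ _]]]]]]].
have [df|df] := eqVneq f^`() 0.
  left; split; first exact: frobenius_of_deriv f_orig neq dec decs df.
  by split=> -[[/original_deriv]]; rewrite df eqxx.
have T := tame_collision_of charFp f_orig neq dec decs df.
have notF : ~ frobenius_collision charFp f.
  by move=> /frobenius_deriv df0; rewrite df0 eqxx in df.
right; rewrite CE.
have [mult|no_mult] :=
  pselect (exists c, multiple_value p (map_poly iota g) (map_poly iota gs) c).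
  right; split=> //; split; last exact: multiple_case_of f_orig dec decs T mult.
  by case=> -[_ no_c] _; apply: no_c; apply/(multiple_originalP iota charFp dec T).
left; split=> //; split; first exact: simple_case_of f_orig dec decs T no_mult.
by case=> -[_ /(multiple_originalP iota charFp dec T)].
Qed.
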